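(* Consider the two-user state-dependent discrete memoryless multiple-access channel (MAC) with cooperating encoders and correlated states described in the context, with finite alphabets $\mathcal X_1,\mathcal X_2,\mathcal S_1,\mathcal S_2,\mathcal Y$, state law $P_{S_1S_2}$ and channel law $P_{Y|X_1X_2S_1S_2}$, where the state sequence $S_1^n$ is known non-causally to encoder 1 only and $S_2^n$ is known non-causally to encoder 2 only. Then the following rate region is achievable: the union, over all finite alphabets $\mathcal U,\mathcal V_1,\mathcal V_2$ and all joint distributions of random variables $(S_1,S_2,U,V_1,V_2,X_1,X_2,Y)$ on $\mathcal S_1\times\mathcal S_2\times\mathcal U\times\mathcal V_1\times\mathcal V_2\times\mathcal X_1\times\mathcal X_2\times\mathcal Y$ of the form $$P(s_1,s_2,u,v_1,v_2,x_1,x_2,y)=P_{S_1S_2}(s_1,s_2)\,P_U(u)\,P_{X_1V_1|US_1}(x_1,v_1|u,s_1)\,P_{X_2V_2|US_2}(x_2,v_2|u,s_2)\,P_{Y|X_1X_2S_1S_2}(y|x_1,x_2,s_1,s_2),$$ of the sets of pairs $(R_1,R_2)$ with $R_1,R_2\ge 0$ and $$R_1\le I(X_1;V_1|U,S_2)-I(V_1;S_1|U,S_2),$$ $$R_2\le I(X_2;V_2|U,S_1)-I(V_2;S_2|U,S_1),$$ $$R_1+R_2\le I(Y;V_1,V_2,U)-I(V_1,V_2;S_1,S_2|U).$$ That is, every such pair $(R_1,R_2)$ belongs to the capacity region (the closure of the set of achievable rate pairs).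
   Context: Channel model. The channel and state are memoryless: $P(y^n|x_1^n,x_2^n,s_1^n,s_2^n)=\prod_{i=1}^nP_{Y|X_1X_2S_1S_2}(y_i|x_{1i},x_{2i},s_{1i},s_{2i})$ and $P(s_1^n,s_2^n)=\prod_{i=1}^nP_{S_1S_2}(s_{1i},s_{2i})$; $S_1$ and $S_2$ may be arbitrarily correlated. Codes. Encoder $i\in\{1,2\}$ has a message $W_i$ uniform on $\mathcal W_i=\{1,\dots,2^{nR_i}\}$ ($2^{nR_i}$ rounded down to an integer if necessary); $W_1$, $W_2$ and the state sequences are independent, apart from the correlation between $S_1^n$ and $S_2^n$. A length-$n$ code of rates $(R_1,R_2)$ consists of encoding functions $$f_{1,j}:\mathcal W_1\times\mathcal S_1^n\times\mathcal X_2^{j-1}\to\mathcal X_1,\qquad f_{2,j}:\mathcal W_2\times\mathcal S_2^n\times\mathcal X_1^{j-1}\to\mathcal X_2,\qquad j=1,\dots,n,$$ and a decoding function $g:\mathcal Y^n\to\mathcal W_1\times\mathcal W_2$. The transmitted symbols are $X_{1,j}=f_{1,j}(W_1,S_1^n,X_2^{j-1})$ and $X_{2,j}=f_{2,j}(W_2,S_2^n,X_1^{j-1})$, i.e. each encoder knows its own state sequence non-causally and observes the other encoder's past transmitted symbols noiselessly and strictly causally (this is what ''cooperating encoders'' means). The decoder outputs $(\hat W_1,\hat W_2)=g(Y^n)$. The average error probability is $$P_e^n=2^{-n(R_1+R_2)}\sum_{w_1,w_2}\Pr\{(\hat W_1,\hat W_2)\ne(w_1,w_2)\mid (w_1,w_2)\text{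 sent}\}.$$ A pair $(R_1,R_2)$ is achievable if there is a sequence of length-$n$ codes of rates $(R_1,R_2)$ with $P_e^n\to0$ as $n\to\infty$; the capacity region is the closure of the set of achievable pairs. Mutual informations are in bits. *)

(* Defs.v *)
From mathcomp Require Import all_boot all_order all_algebra.
From mathcomp Require Import all_classical all_reals all_analysis.

Set Implicit Arguments.
Unset Strict Implicit.
Unset Printing Implicit Defensive.

Import Order.TTheory GRing.Theory Num.Theory.
Import numFieldNormedType.Exports.

Local Open Scope ring_scope.
Local Open Scope classical_set_scope.

(** * Probability mass functions on finite alphabets *)

Record fdist (R : realType) (A : finType) := FDist {
  fdist_val :> A -> R;
  fdist_ge0 : forall a, 0 <= fdist_val a;
  fdist_sum1 : \sum_(a : A) fdist_val a = 1 }.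

Section information.
Variables (R : realType) (Omega : finType) (P : fdist R Omega).

Definition log2 (x : R) : R := ln x / ln 2.

Definition rvpair (A B : Type) (X : Omega -> A) (Y : Omega -> B) (w : Omega) :
  A * B := (X w, Y w).

Definition law (A : finType) (X : Omega -> A) (a : A) : R :=
  \sum_(w | X w == a) P w.

(* In both sums a term whose joint probability vanishes is 0, which is the usual
   convention 0 log 0 = 0; otherwise every denominator is positive. *)
Definition mutual_info (A B : finType) (X : Omega -> A) (Y : Omega -> B) : R :=
  \sum_a \sum_b
    law (rvpair X Y) (a, b) *
    log2 (law (rvpair X Y) (a, b) / (law X a * law Y b)).

(* p(a,b|c) / (p(a|c) p(b|c)) with the conditioning denominators cleared. *)
Definition cond_mutual_info (A B C : finType)
    (X : Omega -> A) (Y : Omega -> B) (Z : Omega -> C) : R :=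
  \sum_a \sum_b \sum_c
    law (rvpair (rvpair X Y) Z) (a, b, c) *
    log2 (law (rvpair (rvpair X Y) Z) (a, b, c) * law Z c /
          (law (rvpair X Z) (a, c) * law (rvpair Y Z) (b, c))).

End information.

(** * Codes with strictly causal cooperation between the encoders *)

(* Time is numbered from 0, so the symbols sent strictly before time [j : 'I_n]
   form a word of length [j]. *)
Definition past (A : finType) (n : nat) (x : {ffun 'I_n -> A}) (j : 'I_n) :
    {ffun 'I_j -> A} :=
  [ffun i => x (widen_ord (ltnW (ltn_ord j)) i)].

Record code (X1 X2 S1 S2 Y : finType) (n M1 M2 : nat) := Code {
  enc1 : forall j : 'I_n,
    'I_M1 -> {ffun 'I_n -> S1} -> {ffun 'I_j -> X2} -> X1;
  enc2 : forall j : 'I_n,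
    'I_M2 -> {ffun 'I_n -> S2} -> {ffun 'I_j -> X1} -> X2;
  dec : {ffun 'I_n -> Y} -> 'I_M1 * 'I_M2 }.

Section error_probability.
Variables (R : realType) (X1 X2 S1 S2 Y : finType).
Variables (PS : fdist R (S1 * S2)%type) (W : X1 -> X2 -> S1 -> S2 -> fdist R Y).
Variables (n M1 M2 : nat) (c : code X1 X2 S1 S2 Y n M1 M2).

(* The mutual recursion defining the two transmitted words, as a system of
   equations; [transmitted_unique] below shows that it has exactly one
   solution. *)
Definition transmitted (w1 : 'I_M1) (w2 : 'I_M2)
    (s1 : {ffun 'I_n -> S1}) (s2 : {ffun 'I_n -> S2})
    (x1 : {ffun 'I_n -> X1}) (x2 : {ffun 'I_n -> X2}) : bool :=
  [forall j : 'I_n, (x1 j == enc1 c w1 s1 (past x2 j)) &&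
                    (x2 j == enc2 c w2 s2 (past x1 j))].

Definition error_given (w1 : 'I_M1) (w2 : 'I_M2) : R :=
  \sum_(s1 : {ffun 'I_n -> S1}) \sum_(s2 : {ffun 'I_n -> S2})
    (\prod_(i < n) PS (s1 i, s2 i)) *
    \sum_(x1 : {ffun 'I_n -> X1})
      \sum_(x2 : {ffun 'I_n -> X2} | transmitted w1 w2 s1 s2 x1 x2)
        \sum_(y : {ffun 'I_n -> Y} | dec c y != (w1, w2))
          \prod_(i < n) W (x1 i) (x2 i) (s1 i) (s2 i) (y i).

Definition average_error : R :=
  (M1 * M2)%:R^-1 * \sum_(w1 < M1) \sum_(w2 < M2) error_given w1 w2.

End error_probability.

(** * Achievable rates and the capacity region *)

Definition num_messages (R : realType) (n : nat) (r : R) : nat :=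
  Num.truncn (2 `^ (n%:R * r)).

Section regions.
Variables (R : realType) (X1 X2 S1 S2 Y : finType).
Variables (PS : fdist R (S1 * S2)%type) (W : X1 -> X2 -> S1 -> S2 -> fdist R Y).

(* Nonnegativity is part of the notion of a rate: a negative rate would give an
   empty message set, for which the average error is vacuously 0. *)
Definition achievable (r : R * R) : Prop :=
  [/\ 0 <= r.1, 0 <= r.2 &
    exists c : forall n : nat,
        code X1 X2 S1 S2 Y n (num_messages n r.1) (num_messages n r.2),
      (fun n => average_error PS W (c n)) @ \oo --> (0 : R)].

Definition capacity_region : set (R * R) := closure [set r | achievable r].

Section single_letter.
Variables U V1 V2 : finType.

Definition joint_alphabet : finType :=
  (S1 * S2 * U * V1 * V2 * X1 * X2 * Y)%type.

Implicit Type w : joint_alphabet.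
Definition rvS1 w : S1 := let: (s1, s2, u, v1, v2, x1, x2, y) := w in s1.
Definition rvS2 w : S2 := let: (s1, s2, u, v1, v2, x1, x2, y) := w in s2.
Definition rvU w : U := let: (s1, s2, u, v1, v2, x1, x2, y) := w in u.
Definition rvV1 w : V1 := let: (s1, s2, u, v1, v2, x1, x2, y) := w in v1.
Definition rvV2 w : V2 := let: (s1, s2, u, v1, v2, x1, x2, y) := w in v2.
Definition rvX1 w : X1 := let: (s1, s2, u, v1, v2, x1, x2, y) := w in x1.
Definition rvX2 w : X2 := let: (s1, s2, u, v1, v2, x1, x2, y) := w in x2.
Definition rvY w : Y := let: (s1, s2, u, v1, v2, x1, x2, y) := w in y.

Definition admissible (P : fdist R joint_alphabet) : Prop :=
  exists (PU : fdist R U)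
         (PX1V1 : U -> S1 -> fdist R (X1 * V1)%type)
         (PX2V2 : U -> S2 -> fdist R (X2 * V2)%type),
    forall s1 s2 u v1 v2 x1 x2 y,
      P (s1, s2, u, v1, v2, x1, x2, y) =
      PS (s1, s2) * PU u * PX1V1 u s1 (x1, v1) * PX2V2 u s2 (x2, v2) *
      W x1 x2 s1 s2 y.

Definition rate_bounds (P : fdist R joint_alphabet) (r : R * R) : Prop :=
  [/\ r.1 <= cond_mutual_info P rvX1 rvV1 (rvpair rvU rvS2)
           - cond_mutual_info P rvV1 rvS1 (rvpair rvU rvS2),
      r.2 <= cond_mutual_info P rvX2 rvV2 (rvpair rvU rvS1)
           - cond_mutual_info P rvV2 rvS2 (rvpair rvU rvS1) &
      r.1 + r.2 <= mutual_info P rvY (rvpair (rvpair rvV1 rvV2) rvU)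
                 - cond_mutual_info P (rvpair rvV1 rvV2) (rvpair rvS1 rvS2) rvU].

End single_letter.

Definition rate_region : set (R * R) :=
  [set r | 0 <= r.1 /\ 0 <= r.2 /\
     exists (U V1 V2 : finType) (P : fdist R (joint_alphabet U V1 V2)),
       admissible P /\ rate_bounds P r].

End regions.

Lemma transmitted_unique (X1 X2 S1 S2 Y : finType) (n M1 M2 : nat)
    (c : code X1 X2 S1 S2 Y n M1 M2) (w1 : 'I_M1) (w2 : 'I_M2)
    (s1 : {ffun 'I_n -> S1}) (s2 : {ffun 'I_n -> S2}) :
  exists! x : {ffun 'I_n -> X1} * {ffun 'I_n -> X2},
    transmitted c w1 w2 s1 s2 x.1 x.2.
Proof.
pose F (x : {ffun 'I_n -> X1} * {ffun 'I_n -> X2}) :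
    {ffun 'I_n -> X1} * {ffun 'I_n -> X2} :=
  ([ffun j : 'I_n => enc1 c w1 s1 (past x.2 j)],
   [ffun j : 'I_n => enc2 c w2 s2 (past x.1 j)]).
pose agree k (x x' : {ffun 'I_n -> X1} * {ffun 'I_n -> X2}) :=
  forall j : 'I_n, (j < k)%N -> x.1 j = x'.1 j /\ x.2 j = x'.2 j.
have causal k x x' : agree k x x' -> agree k.+1 (F x) (F x').
  move=> xx' j; rewrite ltnS => jk; rewrite /= !ffunE.
  split; congr (_ _ _ _ _); apply/ffunP => i; rewrite !ffunE;
    by case: (xx' (widen_ord (ltnW (ltn_ord j)) i) (leq_trans (ltn_ord i) jk)).
have agreeP x x' : agree n x x' -> x = x'.
  case: x x' => [x1 x2] [x1' x2'] xx'.
  by congr (_, _); apply/ffunP => j; case: (xx' j (ltn_ord j)).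
have transmittedP x : transmitted c w1 w2 s1 s2 x.1 x.2 <-> F x = x.
  split=> [/forallP h|Fx].
    apply: agreeP => j _; rewrite !ffunE.
    by have /andP[/eqP -> /eqP ->] := h j.
  by apply/forallP => j; rewrite -{1 3}Fx !ffunE !eqxx.
have [x0 _] : exists x0 : {ffun 'I_n -> X1} * {ffun 'I_n -> X2}, True.
  case: (posnP n) => [n0|n_gt0].
    have e (j : 'I_n) : False by case: j => j; rewrite n0.
    by exists (finfun (fun j => False_rect X1 (e j)),
               finfun (fun j => False_rect X2 (e j))).
  pose o := Ordinal n_gt0.
  have e (j : 'I_o) : False by case: j.
  by exists ([ffun=> enc1 c w1 s1 (finfun (fun j : 'I_o => False_rect X2 (e j)))],
             [ffun=> enc2 c w2 s2 (finfun (fun j : 'I_o => False_rect X1 (e j)))]).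
have iterP k : agree k (F (iter k F x0)) (iter k F x0).
  by elim: k => [|k IH] //; exact: causal.
exists (iter n F x0); split; first by apply/transmittedP; exact: agreeP.
move=> x /transmittedP Fx; apply: agreeP.
suff : forall k, agree k (iter k F x0) x by apply.
by elim=> [|k IH] //=; rewrite -Fx; exact: causal.
Qed.

(* Main.v *)
(* Block Markov coding with a likelihood (soft-covering) version of Gelfand-Pinsker
   binning.  In every block the cloud centre u is indexed by the message pair of the
   previous block, and each encoder, given its messages and its states, draws a codeword v
   from its bin with probability proportional to the likelihood ratio p(x, v | u, s) / p(v | u),
   together with its channel input x.  As soon as the bin rate exceeds I(V;S|U), a second
   moment bound shows that this is as good as drawing (x, v) from p(x, v | u, s) with a
   uniform index and independent other codewords; the three error events of a block (each
   encoder decoding the message of the other one from the cribbed symbols and its own states,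
   the receiver decoding u backwards) are then union bounds on threshold tests.  The
   resulting one-block bound holds for arbitrary finite alphabets; applied to words of n
   letters it tends to 0 by Chebyshev's inequality for the information densities.  The
   same random codebook serves all blocks: the error of the chain is at most the sum of
   the block errors, by comparison with encoders that know the past messages of each
   other, so only expectations over one codebook are needed. *)

Require Import Defs.
From mathcomp Require Import all_boot all_order all_algebra.
From mathcomp Require Import all_classical all_reals all_analysis.
From mathcomp Require Import ring lra.

Set Implicit Arguments.
Unset Strict Implicit.
Unset Printing Implicit Defensive.

Import Order.TTheory GRing.Theory Num.Theory.
Import numFieldNormedType.Exports.

Local Open Scope classical_set_scope.
Local Open Scope ring_scope.

(** The words [v1] and [v2] are correlated through the states, while the two codebooks are drawn
    independently given the cloud centre, from p(v1|u) and p(v2|u). Selection by likelihood lets the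
    users be covered one after the other, with no joint typicality of the pair; the mismatch is
    carried by the density of the receiver, whose reference measure is this product, and it cancels
    in the sum rate against the two bin rates. A stochastic encoder is not a code, so its choices
    are tabulated in advance and the tables belong to the codebook. The block bounds hold for every
    fixed message pair; no distribution of block messages enters, and the messages of the whole
    transmission are embedded in words of block messages by arbitrary injections. One block beyond
    the [B] message blocks is spent so that backward decoding starts from a known pair, at a rate
    loss that vanishes as [B] grows. As the capacity region is a closure, rates may be lowered by a
    fixed amount, which is split into the margins of the exponents. *)

Section Expectation.
Variable R : realType.

Definition Ex (A : finType) (P : fdist R A) (f : A -> R) : R :=
  \sum_a P a * f a.

Section OneLaw.
Variables (A : finType) (P : fdist R A).
Implicit Types f g : A -> R.

Lemma Ex_eq f g : (forall a, P a != 0 -> f a = g a) -> Ex P f = Ex P g.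
Proof.
move=> fg; apply: eq_bigr => a _.
by have [->|/fg ->//] := eqVneq (P a) 0; rewrite !mul0r.
Qed.

Lemma Ex_ext f g : f =1 g -> Ex P f = Ex P g.
Proof. by move=> fg; apply: Ex_eq => a _. Qed.

Lemma Ex_le f g : (forall a, P a != 0 -> f a <= g a) -> Ex P f <= Ex P g.
Proof.
move=> fg; apply: ler_sum => a _.
have [->|/fg ?] := eqVneq (P a) 0; first by rewrite !mul0r.
by rewrite ler_wpM2l // fdist_ge0.
Qed.

Lemma Ex_cst (k : R) : Ex P (fun=> k) = k.
Proof. by rewrite /Ex -mulr_suml fdist_sum1 mul1r. Qed.

Lemma ExD f g : Ex P (fun a => f a + g a) = Ex P f + Ex P g.
Proof. by rewrite /Ex -big_split /=; apply: eq_bigr => a _; rewrite mulrDr. Qed.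

Lemma ExDr f (k : R) : Ex P (fun a => f a + k) = Ex P f + k.
Proof. by rewrite ExD Ex_cst. Qed.

Lemma ExZ (k : R) f : Ex P (fun a => k * f a) = k * Ex P f.
Proof. by rewrite /Ex mulr_sumr; apply: eq_bigr => a _; rewrite mulrCA. Qed.

Lemma ExZr (k : R) f : Ex P (fun a => f a * k) = Ex P f * k.
Proof. by rewrite /Ex mulr_suml; apply: eq_bigr => a _; rewrite mulrA. Qed.

Lemma ExN f : Ex P (fun a => - f a) = - Ex P f.
Proof. by rewrite /Ex -sumrN; apply: eq_bigr => a _; rewrite mulrN. Qed.

Lemma ExB f g : Ex P (fun a => f a - g a) = Ex P f - Ex P g.
Proof. by rewrite ExD ExN. Qed.

Lemma Ex_sum (I : finType) (Q : pred I) (F : I -> A -> R) :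
  Ex P (fun a => \sum_(i | Q i) F i a) = \sum_(i | Q i) Ex P (F i).
Proof.
by rewrite /Ex exchange_big /=; apply: eq_bigr => a _; rewrite mulr_sumr.
Qed.

Lemma Ex_ge0 f : (forall a, 0 <= f a) -> 0 <= Ex P f.
Proof. by move=> f0; apply: sumr_ge0 => a _; rewrite mulr_ge0 ?fdist_ge0. Qed.

Lemma Ex_le_cst f (k : R) : (forall a, P a != 0 -> f a <= k) -> Ex P f <= k.
Proof. by move=> fk; rewrite -[leRHS]Ex_cst; exact: Ex_le. Qed.

Lemma Ex_ge_cst f (k : R) : (forall a, P a != 0 -> k <= f a) -> k <= Ex P f.
Proof. by move=> fk; rewrite -[leLHS]Ex_cst; exact: Ex_le. Qed.

Lemma fdist_inhabited : exists a, P a != 0.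
Proof.
apply: contrapT => /forallNP h; have := fdist_sum1 P.
rewrite big1 => [/eqP|a _]; first by rewrite eq_sym oner_eq0.
by apply/eqP/negPn/negP => /h.
Qed.

(** First-moment method, by which one deterministic scheme is extracted from a random one. *)
Lemma exists_le_Ex f (k : R) : Ex P f <= k -> exists a, f a <= k.
Proof.
move=> fk; apply: contrapT => /forallNP h.
have [a Pa] := fdist_inhabited.
suff : k < Ex P f by rewrite ltNge fk.
rewrite -[ltLHS]Ex_cst -subr_gt0 -ExB /Ex (bigD1 a) //=.
have h' b : 0 < f b - k by rewrite subr_gt0 ltNge; apply/negP.
apply: ltr_wpDr; first by apply: sumr_ge0 => b _; rewrite mulr_ge0 ?fdist_ge0 ?ltW.
by rewrite mulr_gt0 // lt_def Pa fdist_ge0.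
Qed.

End OneLaw.

Lemma Ex_law (A : finType) (P P' : fdist R A) (f : A -> R) :
  P =1 P' -> Ex P f = Ex P' f.
Proof. by move=> PP'; apply: eq_bigr => a _; rewrite PP'. Qed.

Lemma sum_pair (A B : finType) (F : A * B -> R) :
  \sum_c F c = \sum_a \sum_b F (a, b).
Proof. by rewrite pair_bigA; apply: eq_bigr => -[]. Qed.

Lemma Ex_swap (A B : finType) (P : fdist R A) (Q : fdist R B) (F : A -> B -> R) :
  Ex P (fun a => Ex Q (F a)) = Ex Q (fun b => Ex P (F^~ b)).
Proof.
rewrite /Ex; under eq_bigr do rewrite mulr_sumr.
rewrite exchange_big /=; apply: eq_bigr => b _; rewrite mulr_sumr.
by apply: eq_bigr => a _; rewrite mulrCA.
Qed.

(** * Products of laws *)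

Section Bind.
Variables (A B : finType) (P : fdist R A) (K : A -> fdist R B).

Definition bind_val (c : A * B) : R := P c.1 * K c.1 c.2.

Lemma bind_ge0 c : 0 <= bind_val c.
Proof. by rewrite mulr_ge0 ?fdist_ge0. Qed.

Lemma bind_sum1 : \sum_c bind_val c = 1.
Proof.
rewrite sum_pair -[RHS](Ex_cst P 1).
by apply: eq_bigr => a _; rewrite /bind_val /= -mulr_sumr fdist_sum1.
Qed.

Definition bind := FDist bind_ge0 bind_sum1.

Lemma Ex_bind (F : A * B -> R) :
  Ex bind F = Ex P (fun a => Ex (K a) (fun b => F (a, b))).
Proof.
rewrite /Ex /=; under [RHS]eq_bigr do rewrite mulr_sumr.
rewrite pair_bigA; apply: eq_bigr => -[a b] _ /=.
by rewrite /bind_val mulrA.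
Qed.

End Bind.

Section Product.
Variables (I A : finType) (Q : I -> fdist R A).

Definition prodf_val (c : {ffun I -> A}) : R := \prod_i Q i (c i).

Lemma prodf_ge0 c : 0 <= prodf_val c.
Proof. by apply: prodr_ge0 => i _; rewrite fdist_ge0. Qed.

Lemma prodf_sum1 : \sum_c prodf_val c = 1.
Proof.
rewrite -(bigA_distr_bigA (fun i a => Q i a)) /= big1 // => i _.
exact: fdist_sum1.
Qed.

Definition prodf := FDist prodf_ge0 prodf_sum1.

Lemma prodf_neq0 c i : prodf c != 0 -> Q i (c i) != 0.
Proof. by apply: contra => /eqP Qi; rewrite /= /prodf_val (bigD1 i) //= Qi mul0r. Qed.

Lemma Ex_prod (f : I -> A -> R) :
  Ex prodf (fun c => \prod_i f i (c i)) = \prod_i Ex (Q i) (f i).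
Proof.
rewrite /Ex /= bigA_distr_bigA; apply: eq_bigr => c _.
by rewrite big_split.
Qed.

Definition upd (c : {ffun I -> A}) (i0 : I) (a : A) : {ffun I -> A} :=
  [ffun i => if i == i0 then a else c i].

Lemma upd_eq c i a : upd c i a i = a.
Proof. by rewrite ffunE eqxx. Qed.

Lemma upd_neq c i a j : j != i -> upd c i a j = c j.
Proof. by rewrite ffunE => /negPf ->. Qed.

(* The map (c, a) |-> (c with a at i0, c i0) is a weight-preserving involution. *)
Lemma Ex_resample (i0 : I) (F : {ffun I -> A} -> R) :
  Ex prodf F = Ex prodf (fun c => Ex (Q i0) (fun a => F (upd c i0 a))).
Proof.
have -> : Ex prodf F = Ex prodf (fun c => Ex (Q i0) (fun=> F c)).
  by apply: Ex_ext => c; rewrite Ex_cst.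
pose h (p : {ffun I -> A} * A) := (upd p.1 i0 p.2, p.1 i0).
have hK : involutive h.
  move=> [c a]; rewrite /h /= upd_eq; congr (_, _).
  by apply/ffunP => i; rewrite !ffunE; case: eqP => [->|].
have toD (G : {ffun I -> A} -> A -> R) : Ex prodf (fun c => Ex (Q i0) (G c)) =
    Ex (bind prodf (fun=> Q i0)) (fun p => G p.1 p.2) by rewrite Ex_bind.
rewrite !toD /Ex (reindex_inj (inv_inj hK)) /=.
apply: eq_bigr => -[c a] _ /=; congr (_ * _).
rewrite /bind_val /= /prodf_val (bigD1 i0) //= upd_eq.
rewrite [in RHS](bigD1 i0) //= mulrAC [RHS]mulrAC; congr (_ * _).
  by rewrite mulrC.
by apply: eq_bigr => i /negPf ii0; rewrite upd_neq ?ii0.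
Qed.

Lemma Ex_coord (i : I) (g : A -> R) : Ex prodf (fun c => g (c i)) = Ex (Q i) g.
Proof.
rewrite (Ex_resample i); under Ex_ext do under Ex_ext do rewrite upd_eq.
by rewrite Ex_cst.
Qed.

Lemma Ex_coord2 (i j : I) (F : A -> A -> R) : i != j ->
  Ex prodf (fun c => F (c i) (c j)) =
  Ex (Q i) (fun a => Ex (Q j) (F a)).
Proof.
move=> ij; rewrite (Ex_resample i) Ex_swap; apply: Ex_ext => a.
under Ex_ext do rewrite upd_eq upd_neq 1?eq_sym //.
exact: Ex_coord.
Qed.

End Product.

(** [G] is expanded over the values [d] of the observed coordinates, so that the weight factors
    coordinate by coordinate; by injectivity each observed coordinate meets a single indicator, and
    the others sum to 1. This restricts the whole transmission to one block. *)
Lemma Ex_inj_marginal (I J A : finType) (Q : I -> fdist R A) (h : J -> I)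
    (G : {ffun J -> A} -> R) : injective h ->
  Ex (prodf Q) (fun c => G [ffun j => c (h j)]) = Ex (prodf (fun j => Q (h j))) G.
Proof.
move=> h_inj; rewrite /Ex /= /prodf_val.
under eq_bigr => c _.
  rewrite (_ : G _ = \sum_(d : {ffun J -> A}) G d * \prod_j (c (h j) == d j)%:R).
    rewrite mulr_sumr; over.
  rewrite (bigD1 [ffun j => c (h j)]) //= big1 ?mulr1 => [|j _]; last first.
    by rewrite ffunE eqxx.
  rewrite big1 ?addr0 // => d dc.
  have [j cj] : exists j, c (h j) != d j.
    apply: contrapT => /forallNP all_eq; case/eqP: dc; apply/ffunP => j.
    by rewrite ffunE; apply/esym/eqP/negPn/negP/all_eq.
  by rewrite (bigD1 j) //= (negPf cj) mul0r mulr0.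
rewrite exchange_big /=; apply: eq_bigr => d _.
have split_h c : \prod_i Q i (c i) * (G d * \prod_j (c (h j) == d j)%:R) =
    G d * \prod_i (Q i (c i) * \prod_(j | h j == i) (c i == d j)%:R).
  rewrite mulrCA; congr (_ * _); rewrite big_split /=; congr (_ * _).
  rewrite (partition_big h predT) //=; apply: eq_bigr => i _.
  by apply: eq_bigr => j /eqP <-.
under eq_bigr do rewrite split_h.
rewrite -mulr_sumr mulrC; congr (_ * _).
rewrite -(bigA_distr_bigA
  (fun i a => Q i a * \prod_(j | h j == i) (a == d j)%:R)) /=.
rewrite (bigID [pred i | i \in codom h]) /= [X in _ * X]big1 ?mulr1; last first.
  move=> i ih; rewrite -[RHS](fdist_sum1 (Q i)); apply: eq_bigr => a _.
  rewrite big1 ?mulr1 // => j /eqP hj; case/negP: ih.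
  by rewrite -hj codom_f.
rewrite (eq_bigl (mem (codom h))) // -big_uniq /=; last first.
  by rewrite /codom map_inj_uniq ?enum_uniq.
rewrite big_image /=; apply: eq_bigr => j _.
rewrite (bigD1 (d j)) //= [X in _ + X]big1 ?addr0.
  by rewrite big1 ?mulr1 // => j' /eqP/h_inj ->; rewrite eqxx.
by move=> a ad; rewrite (bigD1 j) //= (negPf ad) mul0r mulr0.
Qed.

(** Reindexing between words of pairs and pairs of words; it merges successive draws of words into
    one draw of independent letters. *)
Lemma Ex_bind_prodf (I A B : finType) (P : I -> fdist R A) (K : I -> A -> fdist R B)
    (G : {ffun I -> A} -> {ffun I -> B} -> R) :
  Ex (prodf P) (fun a => Ex (prodf (fun i => K i (a i))) (G a)) =
  Ex (prodf (fun i => bind (P i) (K i)))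
     (fun c => G [ffun i => (c i).1] [ffun i => (c i).2]).
Proof.
transitivity (Ex (bind (prodf P) (fun a => prodf (fun i => K i (a i))))
  (fun c => G c.1 c.2)); first by rewrite Ex_bind.
pose h (c : {ffun I -> A * B}) : {ffun I -> A} * {ffun I -> B} :=
  ([ffun i => (c i).1], [ffun i => (c i).2]).
pose h' (p : {ffun I -> A} * {ffun I -> B}) : {ffun I -> A * B} :=
  [ffun i => (p.1 i, p.2 i)].
rewrite /Ex (reindex h) /=; last first.
  exists h' => [c _|[a b] _].
    by apply/ffunP => i; rewrite !ffunE /=; case: (c i).
  by congr (_, _); apply/ffunP => i; rewrite !ffunE.
apply: eq_bigr => c _; congr (_ * _).
rewrite /bind_val /= /prodf_val /= -big_split /=; apply: eq_bigr => i _.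
by rewrite /bind_val !ffunE.
Qed.

(** Cross terms vanish by independence of distinct coordinates and centring; injectivity of [h]
    keeps the coordinates distinct. *)
Lemma second_moment (I J A : finType) (Q : I -> fdist R A) (h : J -> I)
    (g : J -> A -> R) : injective h -> (forall j, Ex (Q (h j)) (g j) = 0) ->
  Ex (prodf Q) (fun c => (\sum_j g j (c (h j))) ^+ 2) =
  \sum_j Ex (Q (h j)) (fun a => g j a ^+ 2).
Proof.
move=> h_inj g0.
under Ex_ext do rewrite expr2 big_distrlr /=.
rewrite Ex_sum; apply: eq_bigr => j _; rewrite Ex_sum (bigD1 j) //= big1 ?addr0.
  rewrite (Ex_coord Q (h j) (fun a => g j a * g j a)).
  by apply: Ex_ext => a; rewrite expr2.
move=> k kj; rewrite (Ex_coord2 _ (fun a b => g j a * g k b)).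
  by under Ex_ext do rewrite ExZ g0 mulr0; rewrite Ex_cst.
by apply: contra kj => /eqP/h_inj ->.
Qed.

End Expectation.

(** * Random covering with a likelihood encoder *)

Section Covering.
Variables (R : realType) (V A L I : finType).
Variables (Q : fdist R V) (p : fdist R A) (v : A -> V) (iota : L -> I) (l0 : L).

Definition lweight (c : {ffun I -> V}) (la : L * A) : R :=
  (v la.2 == c (iota la.1))%:R * (p la.2 / Q (v la.2)).

Definition ltotal (c : {ffun I -> V}) : R := \sum_la lweight c la.

(* The second branch is irrelevant: it only makes the kernel total. *)
Definition lenc_val (c : {ffun I -> V}) (la : L * A) : R :=
  if ltotal c == 0 then (la.1 == l0)%:R * p la.2 else lweight c la / ltotal c.

Lemma lweight_ge0 c la : 0 <= lweight c la.
Proof. by rewrite mulr_ge0 ?divr_ge0 ?fdist_ge0. Qed.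

Lemma ltotal_ge0 c : 0 <= ltotal c.
Proof. by apply: sumr_ge0 => la _; exact: lweight_ge0. Qed.

Lemma lenc_ge0 c la : 0 <= lenc_val c la.
Proof.
rewrite /lenc_val; case: ifP => _; first by rewrite mulr_ge0 ?fdist_ge0.
by rewrite divr_ge0 ?lweight_ge0 ?ltotal_ge0.
Qed.

Lemma lenc_sum1 c : \sum_la lenc_val c la = 1.
Proof.
rewrite /lenc_val; case: (eqVneq (ltotal c) 0) => [_|t0]; last by rewrite -mulr_suml divff.
rewrite sum_pair /= (bigD1 l0) //= [X in _ + X]big1 => [|l /negPf ->].
  by rewrite addr0 -mulr_sumr fdist_sum1 eqxx mul1r.
by apply: big1 => a _; rewrite mul0r.
Qed.

Definition lenc c := FDist (lenc_ge0 c) (lenc_sum1 c).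

(** Density with respect to [Q] of the image of [p] under [v]. *)
Definition lratio (b : V) : R := \sum_(a | v a == b) p a / Q b.

Lemma lratio_ge0 b : 0 <= lratio b.
Proof. by apply: sumr_ge0 => a _; rewrite divr_ge0 ?fdist_ge0. Qed.

Lemma ltotalE c : ltotal c = \sum_l lratio (c (iota l)).
Proof.
rewrite /ltotal sum_pair /=.
apply: eq_bigr => l _; rewrite /lratio [RHS]big_mkcond /=.
apply: eq_bigr => a _; rewrite /lweight /=.
by case: eqP => [->|_]; rewrite ?mul1r ?mul0r.
Qed.

Hypothesis iota_inj : injective iota.
Hypothesis abs_cont : forall a, Q (v a) = 0 -> p a = 0.

Let card_gt0 : 0 < #|L|%:R :> R.
Proof. by rewrite ltr0n; apply/card_gt0P; exists l0. Qed.

(** The random normalization [ltotal] is traded for [#|L|]. This only helps when [ltotal] is at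
    least [#|L|]; otherwise the excess is the fraction 1 - [ltotal] / [#|L|] of a quantity that is
    at most 1 because [F] is. *)
Lemma Ex_lenc_le c (F : L * A -> R) : (forall la, 0 <= F la <= 1) ->
  Ex (lenc c) F <= #|L|%:R^-1 * \sum_la lweight c la * F la
                   + Num.max 0 (1 - ltotal c / #|L|%:R).
Proof.
move=> F01; set N := #|L|%:R.
have [t0|t_neq0] := eqVneq (ltotal c) 0.
  rewrite t0 mul0r subr0 max_r // ler_wpDl //.
    rewrite mulr_ge0 ?invr_ge0 ?ler0n //; apply: sumr_ge0 => la _.
    by rewrite mulr_ge0 ?lweight_ge0; case/andP: (F01 la).
  by apply: Ex_le_cst => la _; case/andP: (F01 la).
set t := ltotal c in t_neq0 *.
have t_gt0 : 0 < t by rewrite lt_def t_neq0 ltotal_ge0.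
set S := \sum_la _.
have -> : Ex (lenc c) F = S / t.
  rewrite /S mulr_suml; apply: eq_bigr => la _ /=.
  by rewrite /lenc_val (negPf t_neq0) mulrAC.
have S_ge0 : 0 <= S.
  by apply: sumr_ge0 => la _; rewrite mulr_ge0 ?lweight_ge0; case/andP: (F01 la).
have St : S <= t.
  apply: ler_sum => la _; rewrite ler_piMr ?lweight_ge0 //; by case/andP: (F01 la).
have [tN|tN] := leP N t.
  apply: (@le_trans _ _ (N^-1 * S)); last by rewrite lerDl le_max lexx.
  by rewrite mulrC ler_wpM2r // lef_pV2 ?posrE.
apply: (@le_trans _ _ (N^-1 * S + (1 - t / N))); last first.
  by rewrite lerD2l le_max lexx orbT.
rewrite -lerBlDl (_ : S / t - N^-1 * S = S / t * (1 - t / N)); last first.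
  by field; rewrite t_neq0 gt_eqF.
rewrite ler_piMl ?ler_pdivrMr ?mul1r // subr_ge0.
by rewrite ler_pdivrMr ?mul1r // ltW.
Qed.

(** Change of measure from [Q] to the image of [p]; absolute continuity settles the points where [Q]
    vanishes. *)
Lemma Ex_lratio (b : V -> R) :
  Ex Q (fun x => lratio x * b x) = Ex p (fun a => b (v a)).
Proof.
rewrite /Ex [RHS](partition_big v predT) //=; apply: eq_bigr => x _.
rewrite /lratio mulr_suml mulr_sumr; apply: eq_bigr => a /eqP va.
rewrite va; have [Qx0|Qx] := eqVneq (Q x) 0; last by field.
by rewrite (abs_cont (a := a)) ?va // !(mul0r, mulr0).
Qed.

(** Truncating the ratio at [T] bounds its second moment by [T] times its mean, and the mean lost is
    the tail under [p]. The deficit is then dominated by a quadratic in the centred sum, whose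
    expectation is a sum of variances. *)
Lemma Ex_ltotal_deficit (T alpha : R) : 0 <= T -> 0 < alpha ->
  Ex (prodf (fun=> Q)) (fun c => Num.max 0 (1 - ltotal c / #|L|%:R)) <=
  Ex p (fun a => (T < lratio (v a))%R%:R) + (alpha + T / (alpha * #|L|%:R)).
Proof.
move=> T0 alpha0; set N := #|L|%:R.
pose t x := lratio x * (lratio x <= T)%R%:R.
pose mu := Ex Q t.
have t_ge0 x : 0 <= t x by rewrite mulr_ge0 ?lratio_ge0.
have mu_ge0 : 0 <= mu by exact: Ex_ge0.
have mu_tail : 1 - mu = Ex p (fun a => (T < lratio (v a))%R%:R).
  rewrite /mu /t (Ex_lratio (fun x => (lratio x <= T)%R%:R)).
  rewrite -{1}(Ex_cst p 1) -ExB; apply: Ex_ext => a.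
  by rewrite leNgt; case: ltP => _; rewrite ?subr0 ?subrr.
have mu_le1 : mu <= 1 by rewrite -subr_ge0 mu_tail Ex_ge0.
have var_t : Ex Q (fun x => (t x - mu) ^+ 2) <= T.
  apply: (@le_trans _ _ (T * mu)); last by rewrite ler_piMr.
  have -> : Ex Q (fun x => (t x - mu) ^+ 2) = Ex Q (fun x => t x ^+ 2) - mu ^+ 2.
    transitivity (Ex Q (fun x => t x ^+ 2 - 2 * mu * t x + mu ^+ 2)).
      by apply: Ex_ext => x; ring.
    by rewrite ExD ExB ExZ Ex_cst -/mu; ring.
  rewrite lerBlDr ler_wpDr ?sqr_ge0 // /mu -ExZ; apply: Ex_le => x _.
  rewrite expr2 ler_wpM2r // /t.
  by case: (leP (lratio x) T) => [tx|_]; rewrite ?mulr1 ?mulr0.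
pose dev (c : {ffun I -> V}) := \sum_l (t (c (iota l)) - mu).
have dev2 : Ex (prodf (fun=> Q)) (fun c => dev c ^+ 2) <= N * T.
  rewrite (second_moment (Q := fun=> Q) (g := fun _ x => t x - mu)) //= => [|l].
    apply: (@le_trans _ _ (\sum_(l : L) T)); first exact: ler_sum.
    by rewrite sumr_const mulr_natl.
  by rewrite ExB Ex_cst subrr.
apply: (@le_trans _ _ (Ex (prodf (fun=> Q))
    (fun c => (1 - mu) + alpha + (alpha * N ^+ 2)^-1 * dev c ^+ 2))).
  apply: Ex_le => c _.
  have Zdev : 1 - ltotal c / N <= (1 - mu) - dev c / N.
    have -> : dev c = \sum_l t (c (iota l)) - N * mu.
      by rewrite /dev big_split /= sumr_const mulNrn mulr_natl.
    rewrite -subr_ge0.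
    have -> : 1 - mu - (\sum_l t (c (iota l)) - N * mu) / N - (1 - ltotal c / N) =
        (ltotal c - \sum_l t (c (iota l))) / N by field; rewrite gt_eqF.
    rewrite divr_ge0 ?ler0n // subr_ge0 ltotalE; apply: ler_sum => l _.
    by rewrite /t; case: (leP _ T) => _; rewrite ?mulr1 // mulr0 lratio_ge0.
  set d := dev c / N in Zdev.
  have -> : (alpha * N ^+ 2)^-1 * dev c ^+ 2 = d ^+ 2 / alpha.
    by rewrite /d; field; rewrite !gt_eqF.
  (* Amounts to 0 <= d^2 + alpha d + alpha^2; no deviation probability has to be estimated. *)
  have d2 : - d <= alpha + d ^+ 2 / alpha.
    by rewrite -(ler_pM2r alpha0) mulrDl divfK ?gt_eqF //; nra.
  have a0 : 0 <= alpha + d ^+ 2 / alpha.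
    by rewrite addr_ge0 ?divr_ge0 ?sqr_ge0 // ltW.
  rewrite ge_max; apply/andP; split; first by rewrite -addrA; apply: addr_ge0 => //; rewrite subr_ge0.
  by apply: le_trans Zdev _; rewrite -[leRHS]addrA lerD2l.
rewrite ExD Ex_cst ExZ mu_tail -addrA lerD2l lerD2l.
apply: (@le_trans _ _ ((alpha * N ^+ 2)^-1 * (N * T))).
  by rewrite ler_wpM2l // invr_ge0 mulr_ge0 ?sqr_ge0 // ltW.
by rewrite le_eqVlt; apply/orP; left; apply/eqP; field; rewrite !gt_eqF.
Qed.

Lemma Ex_lweight (l : L) (a : A) :
  Ex (prodf (fun=> Q)) (fun c => lweight c (l, a)) = p a.
Proof.
rewrite /lweight /= (Ex_coord _ (iota l) (fun x => (v a == x)%:R * (p a / Q (v a)))).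
rewrite ExZr /Ex (bigD1 (v a)) //= eqxx mulr1 big1 ?addr0 => [|x /negPf xa]; last first.
  by rewrite eq_sym xa mulr0.
have [Q0|Q0] := eqVneq (Q (v a)) 0; last by field.
by rewrite (abs_cont Q0) mul0r mulr0.
Qed.

(** Under the weighted measure the other codewords stay independent of the selected one, which makes
    union bounds over wrong codewords possible. *)
Lemma Ex_lweight2 (l : L) (a : A) (i : I) (g : V -> R) : i != iota l ->
  Ex (prodf (fun=> Q)) (fun c => lweight c (l, a) * g (c i)) = p a * Ex Q g.
Proof.
move=> il; rewrite -(Ex_lweight l a) /lweight /=.
rewrite (Ex_coord2 _ (fun x y => (v a == x)%:R * (p a / Q (v a)) * g y)) 1?eq_sym //.
rewrite (Ex_coord _ (iota l) (fun x => (v a == x)%:R * (p a / Q (v a)))).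
by rewrite -ExZr; apply: Ex_ext => x; rewrite ExZ.
Qed.

(* Up to the covering error, the pair chosen by the encoder behaves as if its
   index were uniform, its letter had law p and the other codewords were
   independent of it. *)
Lemma covering (T alpha : R) (F : {ffun I -> V} -> L * A -> R) (G : A -> R)
    (g : A -> V -> R) : 0 <= T -> 0 < alpha ->
  (forall c la, 0 <= F c la <= 1) ->
  (forall (c : {ffun I -> V}) l a, v a = c (iota l) ->
     F c (l, a) <= G a + \sum_(i | i \notin codom iota) g a (c i)) ->
  Ex (prodf (fun=> Q)) (fun c => Ex (lenc c) (F c)) <=
  Ex p (fun a => G a + #|[pred i | i \notin codom iota]|%:R * Ex Q (g a)) +
  (Ex p (fun a => (T < lratio (v a))%R%:R) + (alpha + T / (alpha * #|L|%:R))).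
Proof.
move=> T0 alpha0 F01 FG.
apply: le_trans (_ : _ <= Ex (prodf (fun=> Q)) (fun c =>
    #|L|%:R^-1 * (\sum_la lweight c la * F c la) +
    Num.max 0 (1 - ltotal c / #|L|%:R))) _.
  by apply: Ex_le => c _; exact: Ex_lenc_le.
rewrite [leLHS]ExD; apply: lerD; last exact: Ex_ltotal_deficit.
apply: le_trans (_ : _ <= Ex (prodf (fun=> Q)) (fun c => #|L|%:R^-1 *
    (\sum_la (lweight c la * G la.2 +
      \sum_(i | i \notin codom iota) lweight c la * g la.2 (c i))))) _.
  apply: Ex_le => c _; rewrite ler_wpM2l ?invr_ge0 ?ler0n //.
  apply: ler_sum => -[l a] _ /=; rewrite -mulr_sumr -mulrDr.
  have [ca|ca] := eqVneq (v a) (c (iota l)).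
    by rewrite ler_wpM2l ?lweight_ge0 //; exact: FG.
  by rewrite /lweight /= (negPf ca) !mul0r.
rewrite ExZ Ex_sum sum_pair.
rewrite (eq_bigr (fun=> Ex p (fun a =>
    G a + #|[pred i | i \notin codom iota]|%:R * Ex Q (g a)))) => [|l _].
  by rewrite sumr_const -[X in _ * X]mulr_natl mulKf // gt_eqF.
apply: eq_bigr => a _; rewrite ExD ExZr Ex_lweight Ex_sum mulrDr /=.
rewrite (eq_bigr (fun=> p a * Ex Q (g a))) => [|i il]; last first.
  by rewrite (Ex_lweight2 a (g a)) //; apply: contra il => /eqP ->; exact: codom_f.
by rewrite sumr_const mulrCA mulr_natl.
Qed.

End Covering.

(** * One block *)

Section Threshold.
Variable R : realType.

Lemma markov_ind (t x : R) : 0 < t -> 0 <= x -> (t < x)%R%:R <= x / t.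
Proof.
move=> t0 x0; case: ltP => [tx|_]; last by rewrite divr_ge0 // ltW.
by rewrite ler_pdivlMr // mul1r ltW.
Qed.

Lemma ind01 (b : bool) : 0 <= (b%:R : R) <= 1.
Proof. by case: b; rewrite ?lexx ?ler01. Qed.

Lemma Ex01 (A : finType) (P : fdist R A) (f : A -> R) :
  (forall a, 0 <= f a <= 1) -> 0 <= Ex P f <= 1.
Proof.
move=> f01; apply/andP; split; first by apply: Ex_ge0 => a; case/andP: (f01 a).
by apply: Ex_le_cst => a _; case/andP: (f01 a).
Qed.

Definition covering_error (V A L : finType) (Q : fdist R V) (p : fdist R A)
    (v : A -> V) (T alpha : R) : R :=
  Ex p (fun a => (T < lratio Q p v (v a))%R%:R) + (alpha + T / (alpha * #|L|%:R)).

Section OneUser.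
Variables (V A X K L : finType) (Q : fdist R V) (p : fdist R A).
Variables (v : A -> V) (x : A -> X) (k0 : K) (l0 : L).
Variables (rho : V -> X -> R) (t : R).

Definition threshold_dec (c : {ffun K * L -> V}) (xx : X) : K :=
  odflt k0 [pick k | [exists l, t < rho (c (k, l)) xx]].

(** A wrong estimate means that the true codeword fails the test or that a codeword of another bin
    passes it. Codewords of the same bin do no harm, whence the count [#|K|.-1 * #|L|]; each false
    pass costs at most 1/t by Markov's inequality. *)
Lemma threshold_dec_error (T alpha : R) (m : K) : 0 <= T -> 0 < alpha -> 0 < t ->
  (forall a, Q (v a) = 0 -> p a = 0) ->
  (forall b xx, 0 <= rho b xx) ->
  (forall xx, Ex Q (rho^~ xx) <= 1) ->
  Ex (prodf (fun=> Q)) (fun c => Ex (lenc Q p v (pair m) l0 c)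
    (fun la => (threshold_dec c (x la.2) != m)%:R)) <=
  Ex p (fun a => (rho (v a) (x a) <= t)%R%:R) + (#|K|.-1 * #|L|)%:R / t
  + covering_error L Q p v T alpha.
Proof.
move=> T0 alpha0 t0 abs rho0 rho1.
have pair_inj : injective (pair m : L -> K * L) by move=> l l' [].
pose g a b := (t < rho b (x a))%R%:R : R.
apply: le_trans (covering l0 pair_inj abs (G := fun a => (rho (v a) (x a) <= t)%R%:R)
  (g := g) T0 alpha0 _ _) _.
- by move=> *; exact: ind01.
- move=> c l a va; rewrite /threshold_dec; case: eqP => [_|/eqP bad] /=.
    by rewrite addr_ge0 ?ler0n // sumr_ge0.
  rewrite va; case: (leP _ t) => [_|pass] /=.
    by rewrite lerDl sumr_ge0 // => i _; rewrite ler0n.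
  rewrite add0r; move: bad; case: pickP => [k /existsP[l' pass'] /= km|none].
    rewrite (bigD1 (k, l')) /=; last first.
      by apply/codomP => -[l'' [kE]]; rewrite kE eqxx in km.
    by rewrite /g pass' lerDl sumr_ge0 // => i _; rewrite ler0n.
  by have /existsP[] := none m; exists l.
have cardN : #|[pred i | i \notin codom (pair m : L -> K * L)]| = (#|K|.-1 * #|L|)%N.
  have := cardC (mem (codom (pair m : L -> K * L))).
  rewrite card_prod card_codom // => /eqP.
  rewrite -[X in _ == (X * _)%N](prednK (n := #|K|)); last by apply/card_gt0P; exists m.
  by rewrite mulSn eqn_add2l => /eqP <-; apply: eq_card => i; rewrite !inE.
rewrite /covering_error lerD2r ExD; apply: lerD => //; rewrite cardN.
rewrite -[leRHS](Ex_cst p); apply: Ex_le => a _; rewrite ler_wpM2l ?ler0n //.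
apply: (@le_trans _ _ (Ex Q (fun b => rho b (x a) / t))).
  by apply: Ex_le => b _; exact: markov_ind.
by rewrite ExZr ler_piMl // invr_ge0 ltW.
Qed.

End OneUser.

(** The covering bound is applied to each user in turn: with the first codebook frozen, the covering
    cost of the second user is a constant that joins [G]. *)
Lemma covering2 (V1 A1 L1 I1 V2 A2 L2 I2 : finType)
    (Q1 : fdist R V1) (p1 : fdist R A1) (v1 : A1 -> V1) (i1 : L1 -> I1) (l1 : L1)
    (Q2 : fdist R V2) (p2 : fdist R A2) (v2 : A2 -> V2) (i2 : L2 -> I2) (l2 : L2)
    (T1 T2 alpha : R)
    (F : {ffun I1 -> V1} -> {ffun I2 -> V2} -> L1 * A1 -> L2 * A2 -> R)
    (G : A1 -> A2 -> R) :
  injective i1 -> injective i2 ->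
  (forall a, Q1 (v1 a) = 0 -> p1 a = 0) -> (forall a, Q2 (v2 a) = 0 -> p2 a = 0) ->
  0 <= T1 -> 0 <= T2 -> 0 < alpha ->
  (forall c1 c2 la1 la2, 0 <= F c1 c2 la1 la2 <= 1) ->
  (forall (c1 : {ffun I1 -> V1}) (c2 : {ffun I2 -> V2}) l a l' a',
     v1 a = c1 (i1 l) -> v2 a' = c2 (i2 l') ->
     F c1 c2 (l, a) (l', a') <= G a a') ->
  Ex (prodf (fun=> Q1)) (fun c1 => Ex (prodf (fun=> Q2)) (fun c2 =>
    Ex (lenc Q1 p1 v1 i1 l1 c1) (fun la1 => Ex (lenc Q2 p2 v2 i2 l2 c2)
      (fun la2 => F c1 c2 la1 la2)))) <=
  Ex p1 (fun a => Ex p2 (G a)) +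
  (covering_error L1 Q1 p1 v1 T1 alpha + covering_error L2 Q2 p2 v2 T2 alpha).
Proof.
move=> i1_inj i2_inj abs1 abs2 T10 T20 alpha0 F01 FG.
(* The average over the second codebook moves inside the choice of the first encoder, so that the
   first application of [covering] sees one function bounded by 1. *)
under Ex_ext do rewrite Ex_swap.
set e2 := covering_error L2 _ _ _ _ _.
apply: le_trans (covering l1 i1_inj abs1 (G := fun a => Ex p2 (G a) + e2)
  (g := fun _ _ => 0) T10 alpha0 _ _) _.
- by move=> c la; apply: Ex01 => c2; exact: Ex01.
- move=> c l a va; rewrite big1 ?addr0 //.
  apply: le_trans (covering l2 i2_inj abs2 (G := G a)
    (g := fun _ _ => 0) T20 alpha0 _ _) _ => //.
    by move=> c2 l' a' va'; rewrite big1 ?addr0 //; exact: FG.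
  by rewrite lerD2r; apply: Ex_le => a' _; rewrite Ex_cst mulr0 addr0.
rewrite -/(covering_error L1 Q1 p1 v1 T1 alpha).
rewrite [X in _ <= _ + X]addrC [leRHS]addrA lerD2r.
apply: (@le_trans _ _ (Ex p1 (fun a => Ex p2 (G a) + e2))).
  by apply: Ex_le => a _; rewrite Ex_cst mulr0 addr0.
by rewrite ExD Ex_cst.
Qed.

End Threshold.

(* [est1] is run by encoder 2 and estimates the message of encoder 1, [est2] is
   its mirror image; their first argument and that of [benc1], [benc2] is the
   message pair of the previous block.  Backward decoding: [bdec] estimates that
   previous pair from the message pair of the current block. *)
Record block_scheme (K1 K2 S1 S2 X1 X2 Y : Type) := BlockScheme {
  benc1 : K1 * K2 -> K1 -> S1 -> X1;
  benc2 : K1 * K2 -> K2 -> S2 -> X2;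
  est1 : K1 * K2 -> S2 -> X1 -> K1;
  est2 : K1 * K2 -> S1 -> X2 -> K2;
  bdec : K1 * K2 -> Y -> K1 * K2 }.

Section SchemeError.
Variables (R : realType) (K1 K2 S S1 S2 X1 X2 Y : finType).
Variables (sg1 : S -> S1) (sg2 : S -> S2) (PS : fdist R S).
Variables (W : X1 -> X2 -> S -> fdist R Y).

Definition block_fail (sc : block_scheme K1 K2 S1 S2 X1 X2 Y) (m' m : K1 * K2)
    (s : S) (y : Y) : R :=
  (est1 sc m' (sg2 s) (benc1 sc m' m.1 (sg1 s)) != m.1)%:R +
  (est2 sc m' (sg1 s) (benc2 sc m' m.2 (sg2 s)) != m.2)%:R +
  (bdec sc m y != m')%:R.

Definition block_error (sc : block_scheme K1 K2 S1 S2 X1 X2 Y) (m' m : K1 * K2) : R :=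
  Ex PS (fun s =>
    Ex (W (benc1 sc m' m.1 (sg1 s)) (benc2 sc m' m.2 (sg2 s)) s)
       (block_fail sc m' m s)).

End SchemeError.

(** * Random coding bound for a single block *)

Section OneShot.
Variables (R : realType) (K1 K2 L1 L2 S S1 S2 U A1 A2 X1 X2 V1 V2 Y : finType).
Variables (k1 : K1) (k2 : K2) (l1 : L1) (l2 : L2).
Variables (sg1 : S -> S1) (sg2 : S -> S2).
Variables (x1 : A1 -> X1) (v1 : A1 -> V1) (x2 : A2 -> X2) (v2 : A2 -> V2).
Variables (PS : fdist R S) (PU : fdist R U).
Variables (P1 : U -> S1 -> fdist R A1) (P2 : U -> S2 -> fdist R A2).
Variables (W : X1 -> X2 -> S -> fdist R Y).
Variables (Q1 : U -> fdist R V1) (Q2 : U -> fdist R V2).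
Variables (rho1 : U -> V1 -> X1 -> S2 -> R) (rho2 : U -> V2 -> X2 -> S1 -> R).
Variables (tau : U -> V1 -> V2 -> Y -> R).
Variables (T1 T2 t1 t2 t3 alpha : R).

Hypothesis abs1 : forall u s a, PS s != 0 -> Q1 u (v1 a) = 0 -> P1 u (sg1 s) a = 0.
Hypothesis abs2 : forall u s a, PS s != 0 -> Q2 u (v2 a) = 0 -> P2 u (sg2 s) a = 0.
Hypothesis rho1_ge0 : forall u v x s, 0 <= rho1 u v x s.
Hypothesis rho2_ge0 : forall u v x s, 0 <= rho2 u v x s.
Hypothesis tau_ge0 : forall u v v' y, 0 <= tau u v v' y.
Hypothesis rho1_le1 : forall u x s, Ex (Q1 u) (fun v => rho1 u v x s) <= 1.
Hypothesis rho2_le1 : forall u x s, Ex (Q2 u) (fun v => rho2 u v x s) <= 1.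
Hypothesis tau_le1 : forall y,
  Ex PU (fun u => Ex (Q1 u) (fun v => Ex (Q2 u) (fun v' => tau u v v' y))) <= 1.
Hypotheses (T1_ge0 : 0 <= T1) (T2_ge0 : 0 <= T2) (alpha_gt0 : 0 < alpha).
Hypotheses (t1_gt0 : 0 < t1) (t2_gt0 : 0 < t2) (t3_gt0 : 0 < t3).

(** The ideal law that covering substitutes for the coded block: one draw of each variable along the
    factorization, without a codebook. *)
Definition Ejoint (G : U -> S -> A1 -> A2 -> Y -> R) : R :=
  Ex PU (fun u => Ex PS (fun s => Ex (P1 u (sg1 s)) (fun a1 =>
    Ex (P2 u (sg2 s)) (fun a2 => Ex (W (x1 a1) (x2 a2) s) (G u s a1 a2))))).

Lemma Ejoint_le G G' : (forall u s a1 a2 y, G u s a1 a2 y <= G' u s a1 a2 y) ->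
  Ejoint G <= Ejoint G'.
Proof. by move=> GG'; do 5![apply: Ex_le => ? _]. Qed.

Lemma EjointD G G' : Ejoint (fun u s a1 a2 y => G u s a1 a2 y + G' u s a1 a2 y) =
  Ejoint G + Ejoint G'.
Proof.
rewrite /Ejoint -ExD; apply: Ex_ext => u; rewrite -ExD; apply: Ex_ext => s.
rewrite -ExD; apply: Ex_ext => a1; rewrite -ExD; apply: Ex_ext => a2.
exact: ExD.
Qed.

Lemma Ejoint_cst (k : R) : Ejoint (fun _ _ _ _ _ => k) = k.
Proof.
rewrite /Ejoint -[RHS](Ex_cst PU); apply: Ex_ext => u.
rewrite -[RHS](Ex_cst PS); apply: Ex_ext => s.
rewrite -[RHS](Ex_cst (P1 u (sg1 s))); apply: Ex_ext => a1.
rewrite -[RHS](Ex_cst (P2 u (sg2 s))); apply: Ex_ext => a2.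
exact: Ex_cst.
Qed.

Lemma Ejoint_swap (D : finType) (P : fdist R D) G :
  Ex P (fun d => Ejoint (G d)) =
  Ejoint (fun u s a1 a2 y => Ex P (fun d => G d u s a1 a2 y)).
Proof.
rewrite /Ejoint Ex_swap; apply: Ex_ext => u; rewrite Ex_swap; apply: Ex_ext => s.
rewrite Ex_swap; apply: Ex_ext => a1; rewrite Ex_swap; apply: Ex_ext => a2.
exact: Ex_swap.
Qed.

Local Notation C1 := {ffun K1 * L1 -> V1}.
Local Notation C2 := {ffun K2 * L2 -> V2}.

(** What the message pair of the previous block indexes: a cloud centre with its two satellite
    codebooks. *)
Definition cell : finType := (U * C1 * C2)%type.
(** All that the choice of encoder 1 depends on. A table of choices indexed by keys turns the
    stochastic encoder into a deterministic one. *)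
Definition key1 : finType := (U * C1 * K1 * S1)%type.
Definition key2 : finType := (U * C2 * K2 * S2)%type.

Definition cell_law : fdist R cell :=
  bind (bind PU (fun u => prodf (fun=> Q1 u))) (fun uc => prodf (fun=> Q2 uc.1)).

Definition sel1 (k : key1) : fdist R (L1 * A1)%type :=
  lenc (Q1 k.1.1.1) (P1 k.1.1.1 k.2) v1 (pair k.1.2) l1 k.1.1.2.
Definition sel2 (k : key2) : fdist R (L2 * A2)%type :=
  lenc (Q2 k.1.1.1) (P2 k.1.1.1 k.2) v2 (pair k.1.2) l2 k.1.1.2.

Definition randomness : finType :=
  ({ffun K1 * K2 -> cell} * {ffun key1 -> L1 * A1} * {ffun key2 -> L2 * A2})%type.

Definition random_law : fdist R randomness :=
  bind (bind (prodf (fun=> cell_law)) (fun=> prodf sel1)) (fun=> prodf sel2).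

Definition passes (c : cell) (m : K1 * K2) (l : L1) (l' : L2) (y : Y) : bool :=
  t3 < tau c.1.1 (c.1.2 (m.1, l)) (c.2 (m.2, l')) y.

Definition pair_dec (cb : {ffun K1 * K2 -> cell}) (m : K1 * K2) (y : Y) : K1 * K2 :=
  odflt (k1, k2) [pick m' | [exists l, [exists l', passes (cb m') m l l' y]]].

Definition hat1 (c : cell) (s2 : S2) (x : X1) : K1 :=
  threshold_dec k1 (fun v x => rho1 c.1.1 v x s2) t1 c.1.2 x.
Definition hat2 (c : cell) (s1 : S1) (x : X2) : K2 :=
  threshold_dec k2 (fun v x => rho2 c.1.1 v x s1) t2 c.2 x.

Definition key1_of (c : cell) (m : K1) (s : S1) : key1 := (c.1.1, c.1.2, m, s).
Definition key2_of (c : cell) (m : K2) (s : S2) : key2 := (c.1.1, c.2, m, s).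

Definition random_scheme (w : randomness) : block_scheme K1 K2 S1 S2 X1 X2 Y := {|
  benc1 := fun m' m s => x1 (w.1.2 (key1_of (w.1.1 m') m s)).2;
  benc2 := fun m' m s => x2 (w.2 (key2_of (w.1.1 m') m s)).2;
  est1 := fun m' => hat1 (w.1.1 m');
  est2 := fun m' => hat2 (w.1.1 m');
  bdec := pair_dec w.1.1 |}.

Section Messages.
Variables m' m : K1 * K2.

Definition Eblock (c : cell) (F : S -> L1 * A1 -> L2 * A2 -> Y -> R) : R :=
  Ex PS (fun s => Ex (sel1 (key1_of c m.1 (sg1 s))) (fun la1 =>
    Ex (sel2 (key2_of c m.2 (sg2 s))) (fun la2 =>
      Ex (W (x1 la1.2) (x2 la2.2) s) (F s la1 la2)))).

Lemma EblockD c F G : Eblock c (fun s la1 la2 y => F s la1 la2 y + G s la1 la2 y) =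
  Eblock c F + Eblock c G.
Proof.
rewrite /Eblock -ExD; apply: Ex_ext => s; rewrite -ExD; apply: Ex_ext => la1.
rewrite -ExD; apply: Ex_ext => la2; exact: ExD.
Qed.

Lemma Ex_random_law (F : randomness -> R) : Ex random_law F =
  Ex (prodf (fun=> cell_law)) (fun cb => Ex (prodf sel1) (fun f1 =>
    Ex (prodf sel2) (fun f2 => F (cb, f1, f2)))).
Proof. by rewrite /random_law !Ex_bind. Qed.

Lemma Ex_cell_law (F : cell -> R) : Ex cell_law F =
  Ex PU (fun u => Ex (prodf (fun=> Q1 u)) (fun c1 =>
    Ex (prodf (fun=> Q2 u)) (fun c2 => F (u, c1, c2)))).
Proof. by rewrite /cell_law !Ex_bind. Qed.

(** For given messages and state, a block consults one entry of each table, so a tabulated choice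
    has the same expectation as a fresh one. *)
Lemma Ex_random_scheme :
  Ex random_law (fun w => block_error sg1 sg2 PS W (random_scheme w) m' m) =
  Ex (prodf (fun=> cell_law)) (fun cb => Eblock (cb m') (fun s la1 la2 y =>
    (hat1 (cb m') (sg2 s) (x1 la1.2) != m.1)%:R +
    (hat2 (cb m') (sg1 s) (x2 la2.2) != m.2)%:R + (pair_dec cb m y != m')%:R)).
Proof.
rewrite Ex_random_law; apply: Ex_ext => cb.
transitivity (Ex (prodf sel1) (fun f1 => Ex PS (fun s =>
    Ex (sel2 (key2_of (cb m') m.2 (sg2 s))) (fun la2 =>
      Ex (W (x1 (f1 (key1_of (cb m') m.1 (sg1 s))).2) (x2 la2.2) s)
        (fun y => (hat1 (cb m') (sg2 s) (x1 (f1 (key1_of (cb m') m.1 (sg1 s))).2)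
                     != m.1)%:R +
          (hat2 (cb m') (sg1 s) (x2 la2.2) != m.2)%:R +
          (pair_dec cb m y != m')%:R))))).
  apply: Ex_ext => f1; rewrite /block_error Ex_swap; apply: Ex_ext => s /=.
  by rewrite -(Ex_coord sel2).
rewrite Ex_swap; apply: Ex_ext => s.
by rewrite -(Ex_coord sel1).
Qed.

Lemma hat1_error :
  Ex cell_law (fun c => Eblock c (fun s la1 la2 y =>
    (hat1 c (sg2 s) (x1 la1.2) != m.1)%:R)) <=
  Ejoint (fun u s a1 a2 y => (rho1 u (v1 a1) (x1 a1) (sg2 s) <= t1)%R%:R +
    (T1 < lratio (Q1 u) (P1 u (sg1 s)) v1 (v1 a1))%R%:R) +
  ((#|K1|.-1 * #|L1|)%:R / t1 + (alpha + T1 / (alpha * #|L1|%:R))).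
Proof.
rewrite Ex_cell_law -[X in _ + X]Ejoint_cst -EjointD; apply: Ex_le => u _.
rewrite /Eblock; under Ex_ext do rewrite Ex_swap.
rewrite Ex_swap; apply: Ex_le => s PSs.
apply: le_trans (_ : _ <= Ex (prodf (fun=> Q1 u)) (fun c =>
  Ex (sel1 (u, c, m.1, sg1 s)) (fun la => (threshold_dec k1
    (fun v x => rho1 u v x (sg2 s)) t1 c (x1 la.2) != m.1)%:R))) _.
  apply: Ex_le => c1 _; apply: Ex_le_cst => c2 _; apply: Ex_le => la1 _.
  by do 2![apply: Ex_le_cst => ? _].
apply: le_trans (@threshold_dec_error R _ _ _ _ _ (Q1 u) (P1 u (sg1 s)) v1 x1 k1 l1
  (fun v x => rho1 u v x (sg2 s)) t1 T1 alpha m.1 T1_ge0 alpha_gt0 t1_gt0 _ _ _) _ => //.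
  by move=> a; exact: abs1.
rewrite /covering_error -addrA [X in _ + X]addrCA addrA -ExD.
rewrite -[X in _ + X](Ex_cst (P1 u (sg1 s))) -ExD.
by apply: Ex_le => a _; do 2![apply: Ex_ge_cst => ? _].
Qed.

Lemma hat2_error :
  Ex cell_law (fun c => Eblock c (fun s la1 la2 y =>
    (hat2 c (sg1 s) (x2 la2.2) != m.2)%:R)) <=
  Ejoint (fun u s a1 a2 y => (rho2 u (v2 a2) (x2 a2) (sg1 s) <= t2)%R%:R +
    (T2 < lratio (Q2 u) (P2 u (sg2 s)) v2 (v2 a2))%R%:R) +
  ((#|K2|.-1 * #|L2|)%:R / t2 + (alpha + T2 / (alpha * #|L2|%:R))).
Proof.
rewrite Ex_cell_law -[X in _ + X]Ejoint_cst -EjointD; apply: Ex_le => u _.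
rewrite /Eblock; under Ex_ext do rewrite Ex_swap.
rewrite Ex_swap; apply: Ex_le => s PSs.
apply: le_trans (_ : _ <= Ex (prodf (fun=> Q2 u)) (fun c =>
  Ex (sel2 (u, c, m.2, sg2 s)) (fun la => (threshold_dec k2
    (fun v x => rho2 u v x (sg1 s)) t2 c (x2 la.2) != m.2)%:R))) _.
  apply: Ex_le_cst => c1 _; apply: Ex_le => c2 _; apply: Ex_le_cst => la1 _.
  by apply: Ex_le => la2 _; apply: Ex_le_cst.
apply: le_trans (@threshold_dec_error R _ _ _ _ _ (Q2 u) (P2 u (sg2 s)) v2 x2 k2 l2
  (fun v x => rho2 u v x (sg1 s)) t2 T2 alpha m.2 T2_ge0 alpha_gt0 t2_gt0 _ _ _) _ => //.
  by move=> a; exact: abs2.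
rewrite /covering_error -addrA [X in _ + X]addrCA addrA -ExD.
rewrite -[X in _ + X](Ex_cst (P2 u (sg2 s))) -ExD.
by apply: Ex_ge_cst => a1 _; apply: Ex_le => a _; apply: Ex_ge_cst.
Qed.

(** The cell of the true pair [m'] is left out, so the count does not depend on the cell from which
    the block is sent. *)
Definition false_alarms (cb : {ffun K1 * K2 -> cell}) (y : Y) : R :=
  \sum_(k | k != m') \sum_(l : L1 * L2) (passes (cb k) m l.1 l.2 y)%:R.

Lemma false_alarms_ge0 cb y : 0 <= false_alarms cb y.
Proof. by do 2![apply: sumr_ge0 => ? _]; rewrite ler0n. Qed.

(** Markov's inequality for each test: a wrong cell follows the product law, under which [tau] has
    mean at most 1. Both bin indices are unknown to the receiver, whence the factor
    [#|L1| * #|L2|]. *)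
Lemma Ex_false_alarms y : Ex (prodf (fun=> cell_law)) (false_alarms^~ y) <=
  ((#|K1| * #|K2|).-1 * (#|L1| * #|L2|))%:R / t3.
Proof.
rewrite /false_alarms Ex_sum.
apply: (@le_trans _ _ (\sum_(k | k != m') \sum_(l : L1 * L2) t3^-1)); last first.
  rewrite sumr_const sumr_const -mulrnA card_prod -[leLHS]mulr_natl mulnC.
  suff -> : #|(fun k => k != m')| = (#|K1| * #|K2|).-1 by [].
  by rewrite -card_prod -(cardC1 m'); apply: eq_card.
apply: ler_sum => k km; rewrite Ex_sum; apply: ler_sum => -[l l'] _ /=.
rewrite (Ex_coord _ k (fun c => (passes c m l l' y)%:R)) Ex_cell_law.
apply: (@le_trans _ _ (Ex PU (fun u => Ex (Q1 u) (fun v => Ex (Q2 u)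
  (fun v' => tau u v v' y))) / t3)); last by rewrite ler_piMl // invr_ge0 ltW.
rewrite -ExZr; apply: Ex_le => u _; rewrite -ExZr.
rewrite -(Ex_coord (fun=> Q1 u) (m.1, l) (fun v => Ex (Q2 u) (fun v' => tau u v v' y) / t3)).
apply: Ex_le => c1 _; rewrite -ExZr.
rewrite -(Ex_coord (fun=> Q2 u) (m.2, l') (fun v' => tau u (c1 (m.1, l)) v' y / t3)).
by apply: Ex_le => c2 _; exact: markov_ind.
Qed.

Lemma pair_dec_neq cb u c1 c2 l l' y :
  (pair_dec (upd cb m' (u, c1, c2)) m y != m')%:R <=
  (tau u (c1 (m.1, l)) (c2 (m.2, l')) y <= t3)%R%:R + false_alarms cb y.
Proof.
have H0 := false_alarms_ge0 cb y.
case: (leP _ t3) => [_|pass] /=.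
  by apply: ler_wpDr => //; case: (_ != _).
rewrite add0r /pair_dec; case: pickP => [k /existsP[j /existsP[j' pass']]|none] /=.
  have [//|km /=] := eqVneq k m'.
  rewrite /false_alarms (bigD1 k) //= (bigD1 (j, j')) //=.
  move: pass'; rewrite upd_neq // => ->.
  by rewrite -addrA lerDl addr_ge0 //; do ?[apply: sumr_ge0 => ? _]; rewrite ler0n.
have /existsP[] := none m'; exists l; apply/existsP; exists l'.
by rewrite upd_eq.
Qed.

Lemma pair_dec_error :
  Ex (prodf (fun=> cell_law)) (fun cb => Eblock (cb m') (fun s la1 la2 y =>
    (pair_dec cb m y != m')%:R)) <=
  Ejoint (fun u s a1 a2 y => (tau u (v1 a1) (v2 a2) y <= t3)%R%:R +
    ((T1 < lratio (Q1 u) (P1 u (sg1 s)) v1 (v1 a1))%R%:R +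
    (T2 < lratio (Q2 u) (P2 u (sg2 s)) v2 (v2 a2))%R%:R)) +
  (((#|K1| * #|K2|).-1 * (#|L1| * #|L2|))%:R / t3 +
    ((alpha + T1 / (alpha * #|L1|%:R)) + (alpha + T2 / (alpha * #|L2|%:R)))).
Proof.
set d1 := alpha + T1 / _; set d2 := alpha + T2 / _.
(* The true cell is redrawn, which separates it from the others: [false_alarms cb] then acts as a
   constant while the new cell is covered. *)
rewrite (Ex_resample _ m').
apply: le_trans (_ : _ <= Ex (prodf (fun=> cell_law)) (fun cb =>
  Ejoint (fun u s a1 a2 y => ((tau u (v1 a1) (v2 a2) y <= t3)%R%:R +
    false_alarms cb y) +
    (((T1 < lratio (Q1 u) (P1 u (sg1 s)) v1 (v1 a1))%R%:R + d1) +
    ((T2 < lratio (Q2 u) (P2 u (sg2 s)) v2 (v2 a2))%R%:R + d2))))) _.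
  apply: Ex_le => cb _; under Ex_ext do rewrite upd_eq.
  rewrite Ex_cell_law; apply: Ex_le => u _.
  rewrite /Eblock; under Ex_ext do rewrite Ex_swap.
  rewrite Ex_swap; apply: Ex_le => s PSs.
  have inj1 : injective (pair m.1 : L1 -> K1 * L1) by move=> ? ? [].
  have inj2 : injective (pair m.2 : L2 -> K2 * L2) by move=> ? ? [].
  apply: le_trans (@covering2 R _ _ _ _ _ _ _ _ (Q1 u) (P1 u (sg1 s)) v1
    (pair m.1) l1 (Q2 u) (P2 u (sg2 s)) v2 (pair m.2) l2 T1 T2 alpha
    (fun c1 c2 la1 la2 => Ex (W (x1 la1.2) (x2 la2.2) s) (fun y =>
       (pair_dec (upd cb m' (u, c1, c2)) m y != m')%:R))
    (fun a1 a2 => Ex (W (x1 a1) (x2 a2) s) (fun y =>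
       (tau u (v1 a1) (v2 a2) y <= t3)%R%:R + false_alarms cb y))
    inj1 inj2 _ _ T1_ge0 T2_ge0 alpha_gt0 _ _) _.
  - by move=> a; exact: abs1.
  - by move=> a; exact: abs2.
  - by move=> c1 c2 la1 la2; apply: Ex01 => y; exact: ind01.
  - move=> c1 c2 l a l' a' va va' /=; apply: Ex_le => y _.
    by rewrite va va'; exact: pair_dec_neq.
  rewrite /covering_error -/d1 -/d2.
  have split_sum (f : A1 -> A2 -> R) (g1 : A1 -> R) (g2 : A2 -> R) :
      Ex (P1 u (sg1 s)) (fun a1 => Ex (P2 u (sg2 s)) (fun a2 =>
        f a1 a2 + (g1 a1 + g2 a2))) =
      Ex (P1 u (sg1 s)) (fun a1 => Ex (P2 u (sg2 s)) (f a1)) +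
      (Ex (P1 u (sg1 s)) g1 + Ex (P2 u (sg2 s)) g2).
    rewrite -[X in _ + (_ + X)](Ex_cst (P1 u (sg1 s))) -!ExD.
    by apply: Ex_ext => a1; rewrite ExD ExD Ex_cst.
  rewrite -(ExDr _ _ d1) -(ExDr _ _ d2) -split_sum.
  by do 2![apply: Ex_le => ? _]; rewrite [leRHS]ExDr.
rewrite Ejoint_swap.
rewrite -[X in _ <= _ + X]Ejoint_cst -EjointD.
apply: Ejoint_le => u s a1 a2 y; rewrite ExDr ExD Ex_cst.
by have := Ex_false_alarms y; set p := Ex _ _; lra.
Qed.

End Messages.

(** The factors 2 arise because each covering is paid twice: once for the estimate made by the other
    encoder and once for the receiver. *)
Definition atypical (u : U) (s : S) (a1 : A1) (a2 : A2) (y : Y) : R :=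
  (rho1 u (v1 a1) (x1 a1) (sg2 s) <= t1)%R%:R +
  (rho2 u (v2 a2) (x2 a2) (sg1 s) <= t2)%R%:R +
  (tau u (v1 a1) (v2 a2) y <= t3)%R%:R +
  2 * (T1 < lratio (Q1 u) (P1 u (sg1 s)) v1 (v1 a1))%R%:R +
  2 * (T2 < lratio (Q2 u) (P2 u (sg2 s)) v2 (v2 a2))%R%:R.

Theorem one_shot (m' m : K1 * K2) :
  Ex random_law (fun w => block_error sg1 sg2 PS W (random_scheme w) m' m) <=
  Ejoint atypical +
  ((#|K1|.-1 * #|L1|)%:R / t1 + (#|K2|.-1 * #|L2|)%:R / t2 +
   ((#|K1| * #|K2|).-1 * (#|L1| * #|L2|))%:R / t3 +
   2 * (alpha + T1 / (alpha * #|L1|%:R)) + 2 * (alpha + T2 / (alpha * #|L2|%:R))).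
Proof.
rewrite Ex_random_scheme.
under Ex_ext do rewrite !EblockD.
rewrite !ExD.
rewrite (Ex_coord (fun=> cell_law) m' (fun c => Eblock m c (fun s la1 la2 y =>
  (hat1 c (sg2 s) (x1 la1.2) != m.1)%:R))).
rewrite (Ex_coord (fun=> cell_law) m' (fun c => Eblock m c (fun s la1 la2 y =>
  (hat2 c (sg1 s) (x2 la2.2) != m.2)%:R))).
apply: le_trans (lerD (lerD (hat1_error m) (hat2_error m)) (pair_dec_error m' m)) _.
set e1 := Ejoint _; set e2 := Ejoint _; set e3 := Ejoint _.
have -> : Ejoint atypical = e1 + e2 + e3.
  rewrite /e1 /e2 /e3 -!EjointD /Ejoint.
  by do 5![apply: Ex_ext => ?]; rewrite /atypical; ring.
lra.
Qed.

End OneShot.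

(** * Block Markov encoding and backward decoding *)

Section Words.
Variables (A : Type) (a0 : A) (n : nat).

Definition letter m (x : {ffun 'I_m -> A}) (i : nat) : A := oapp x a0 (insub i).

Definition block m (x : {ffun 'I_m -> A}) (b : nat) : {ffun 'I_n -> A} :=
  [ffun i : 'I_n => letter x (b * n + i)].

Lemma letterE m (x : {ffun 'I_m -> A}) (i : 'I_m) : letter x i = x i.
Proof. by rewrite /letter valK. Qed.

Lemma letter_out m (x : {ffun 'I_m -> A}) i : (m <= i)%N -> letter x i = a0.
Proof. by move=> mi; rewrite /letter insubN // -leqNgt. Qed.

Lemma block_pos_lt N B b (i : 'I_n) : (n * B.+1 <= N)%N -> (b <= B)%N -> (b * n + i < N)%N.
Proof.
move=> nBN bB; apply: leq_trans nBN; rewrite (mulnC n B.+1).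
apply: (@leq_trans (b * n + n)%N); first by rewrite ltn_add2l.
by rewrite -mulSnr leq_mul2r ltnS bB orbT.
Qed.

End Words.

(** Strict causality suffices: the blocks before the one that contains [j] are complete in the past
    of [j]. *)
Lemma block_past (A : finType) (a0 : A) n N (x : {ffun 'I_N -> A}) (j : 'I_N) b :
  (b < j %/ n)%N -> block a0 n (past x j) b = block a0 n x b.
Proof.
move=> bj; apply/ffunP => i; rewrite !ffunE.
have ij : (b * n + i < j)%N.
  apply: (@leq_trans (b.+1 * n)%N); first by rewrite mulSnr ltn_add2l.
  by apply: leq_trans (leq_trunc_div j n); rewrite leq_mul2r bj orbT.
rewrite (_ : b * n + i = Ordinal ij)%N // letterE ffunE.
by rewrite -(letterE a0 x).
Qed.

Definition fst_word (I A B : finType) (s : {ffun I -> A * B}) : {ffun I -> A} :=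
  [ffun i => (s i).1].
Definition snd_word (I A B : finType) (s : {ffun I -> A * B}) : {ffun I -> B} :=
  [ffun i => (s i).2].

Definition state_law (R : realType) (S1 S2 : finType) (PS : fdist R (S1 * S2)%type)
    (I : finType) : fdist R {ffun I -> S1 * S2} := prodf (fun=> PS).

Definition channel_law (R : realType) (X1 X2 S1 S2 Y : finType)
    (W : X1 -> X2 -> S1 -> S2 -> fdist R Y) (I : finType)
    (x1 : {ffun I -> X1}) (x2 : {ffun I -> X2}) (s : {ffun I -> S1 * S2}) :
    fdist R {ffun I -> Y} :=
  prodf (fun i => W (x1 i) (x2 i) (s i).1 (s i).2).

Lemma sum_states (R : realType) (S1 S2 : finType) (PS : fdist R (S1 * S2)%type)
    (I : finType) (F : {ffun I -> S1} -> {ffun I -> S2} -> R) :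
  \sum_(s1 : {ffun I -> S1}) \sum_(s2 : {ffun I -> S2})
    (\prod_i PS (s1 i, s2 i)) * F s1 s2 =
  Ex (state_law PS I) (fun s => F (fst_word s) (snd_word s)).
Proof.
pose h (c : {ffun I -> S1 * S2}) := (fst_word c, snd_word c).
pose h' (p : {ffun I -> S1} * {ffun I -> S2}) : {ffun I -> S1 * S2} :=
  [ffun i => (p.1 i, p.2 i)].
rewrite pair_bigA /= (reindex h) /=; last first.
  exists h' => [c _|[a b] _].
    by apply/ffunP => i; rewrite !ffunE /=; case: (c i).
  by congr (_, _); apply/ffunP => i; rewrite !ffunE.
apply: eq_bigr => c _; congr (_ * _); apply: eq_bigr => i _.
by rewrite !ffunE; case: (c i).
Qed.

(** * Chaining the blocks *)

Section Chain.
Variables (R : realType) (X1 X2 S1 S2 Y K1 K2 : finType) (n B N M1 M2 : nat).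
Variables (x10 : X1) (x20 : X2) (s10 : S1) (s20 : S2) (y0 : Y) (k1 : K1) (k2 : K2).
Variables (w10 : 'I_M1) (w20 : 'I_M2).
Variables (phi1 : 'I_M1 -> {ffun 'I_B -> K1}) (phi2 : 'I_M2 -> {ffun 'I_B -> K2}).
Variable sc : block_scheme K1 K2 {ffun 'I_n -> S1} {ffun 'I_n -> S2}
  {ffun 'I_n -> X1} {ffun 'I_n -> X2} {ffun 'I_n -> Y}.

(** From block [B] on the default [k1] is sent, so the last block carries a pair known to the
    receiver. *)
Definition cur1 w b : K1 := letter k1 (phi1 w) b.
Definition cur2 w b : K2 := letter k2 (phi2 w) b.
Definition prev1 w b : K1 := if b is b'.+1 then cur1 w b' else k1.
Definition prev2 w b : K2 := if b is b'.+1 then cur2 w b' else k2.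

(** Run by encoder 1: its estimate of the message of encoder 2 in block b - 1, with an agreed value
    at 0. The length [m] is free because the observed word stops at the current instant. *)
Fixpoint guess2 m w (s1 : {ffun 'I_N -> S1}) (x2 : {ffun 'I_m -> X2}) b : K2 :=
  if b is b'.+1 then
    est2 sc (prev1 w b', guess2 w s1 x2 b') (block s10 n s1 b') (block x20 n x2 b')
  else k2.

Fixpoint guess1 m w (s2 : {ffun 'I_N -> S2}) (x1 : {ffun 'I_m -> X1}) b : K1 :=
  if b is b'.+1 then
    est1 sc (guess1 w s2 x1 b', prev2 w b') (block s20 n s2 b') (block x10 n x1 b')
  else k1.

(** After [t] steps, the estimate of the pair of block [B - t]. *)
Fixpoint backward (y : {ffun 'I_N -> Y}) t : K1 * K2 :=
  if t is t'.+1 then bdec sc (backward y t') (block y0 n y (B - t')) else (k1, k2).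

(** Positions after block [B] are padded with [x10], since [N] need not be a multiple of the number
    of blocks. *)
Definition send1 w p (s1 : {ffun 'I_N -> S1}) (j : nat) : X1 :=
  if (j %/ n <= B)%N then
    letter x10 (benc1 sc p (cur1 w (j %/ n)) (block s10 n s1 (j %/ n))) (j %% n)
  else x10.
Definition send2 w p (s2 : {ffun 'I_N -> S2}) (j : nat) : X2 :=
  if (j %/ n <= B)%N then
    letter x20 (benc2 sc p (cur2 w (j %/ n)) (block s20 n s2 (j %/ n))) (j %% n)
  else x20.

Definition chain_code : Defs.code X1 X2 S1 S2 Y N M1 M2 := {|
  enc1 := fun j w s1 x2 =>
    send1 w (prev1 w (j %/ n), guess2 w s1 x2 (j %/ n)) s1 j;
  enc2 := fun j w s2 x1 =>
    send2 w (guess1 w s2 x1 (j %/ n), prev2 w (j %/ n)) s2 j;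
  dec := fun y =>
    (odflt w10 [pick w | phi1 w == [ffun b : 'I_B => (backward y (B - b)).1]],
     odflt w20 [pick w | phi2 w == [ffun b : 'I_B => (backward y (B - b)).2]]) |}.

Hypothesis phi1_inj : injective phi1.
Hypothesis phi2_inj : injective phi2.
Hypothesis nBN : (n * B.+1 <= N)%N.

Section FixedMessages.
Variables (w1 : 'I_M1) (w2 : 'I_M2).

Definition cur b := (cur1 w1 b, cur2 w2 b).
Definition prev b := (prev1 w1 b, prev2 w2 b).

(* The words that would be sent if each encoder knew the past messages of the other. *)
Definition genie1 (s1 : {ffun 'I_N -> S1}) : {ffun 'I_N -> X1} :=
  [ffun j : 'I_N => send1 w1 (prev (j %/ n)) s1 j].
Definition genie2 (s2 : {ffun 'I_N -> S2}) : {ffun 'I_N -> X2} :=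
  [ffun j : 'I_N => send2 w2 (prev (j %/ n)) s2 j].

Lemma block_genie1 s1 b : (b <= B)%N ->
  block x10 n (genie1 s1) b = benc1 sc (prev b) (cur1 w1 b) (block s10 n s1 b).
Proof.
move=> bB; apply/ffunP => i; rewrite ffunE.
rewrite (_ : b * n + i = Ordinal (block_pos_lt i nBN bB))%N // letterE ffunE /=.
have n_gt0 : (0 < n)%N by apply: leq_ltn_trans (ltn_ord i).
by rewrite /send1 divnMDl // divn_small // addn0 bB modnMDl modn_small // letterE.
Qed.

Lemma block_genie2 s2 b : (b <= B)%N ->
  block x20 n (genie2 s2) b = benc2 sc (prev b) (cur2 w2 b) (block s20 n s2 b).
Proof.
move=> bB; apply/ffunP => i; rewrite ffunE.
rewrite (_ : b * n + i = Ordinal (block_pos_lt i nBN bB))%N // letterE ffunE /=.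
have n_gt0 : (0 < n)%N by apply: leq_ltn_trans (ltn_ord i).
by rewrite /send2 divnMDl // divn_small // addn0 bB modnMDl modn_small // letterE.
Qed.

(** Induction over the blocks: correct past estimates make each encoder use the cell of the genie,
    so the words of the genie solve the equations of the code. *)
Lemma transmitted_genie s1 s2 :
  (forall b, (b <= B)%N ->
     est1 sc (prev b) (block s20 n s2 b) (block x10 n (genie1 s1) b) = cur1 w1 b /\
     est2 sc (prev b) (block s10 n s1 b) (block x20 n (genie2 s2) b) = cur2 w2 b) ->
  transmitted chain_code w1 w2 s1 s2 (genie1 s1) (genie2 s2).
Proof.
move=> ok; apply/forallP => j; rewrite !ffunE /= /send1 /send2.
case: leqP => [jB|_]; last by rewrite !eqxx.
have guess_ok b : (b <= j %/ n)%N ->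
    guess2 w1 s1 (past (genie2 s2) j) b = prev2 w2 b /\
    guess1 w2 s2 (past (genie1 s1) j) b = prev1 w1 b.
  elim: b => [//|b IH] bj /=; have [-> ->] := IH (ltnW bj).
  rewrite !block_past //.
  by have [-> ->] := ok b (leq_trans (ltnW bj) jB).
by have [-> ->] := guess_ok _ (leqnn _); rewrite !eqxx.
Qed.

(** Backward induction from the default pair of block [B]; injectivity of [phi1] and [phi2] then
    returns the messages. *)
Lemma dec_genie y :
  (forall b, (b <= B)%N -> bdec sc (cur b) (block y0 n y b) = prev b) ->
  dec chain_code y = (w1, w2).
Proof.
move=> ok.
have backE t : (t <= B)%N -> backward y t = cur (B - t).
  elim: t => [_|t IH tB] /=; first by rewrite subn0 /cur /cur1 /cur2 !letter_out.
  rewrite IH ?(ltnW tB) // ok ?leq_subr //.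
  have -> : (B - t = (B - t.+1).+1)%N by rewrite subnSK.
  by [].
have curE (b : 'I_B) : backward y (B - b) = (phi1 w1 b, phi2 w2 b).
  rewrite backE ?leq_subr // subKn ?(ltnW (ltn_ord b)) //.
  by rewrite /cur /cur1 /cur2 !letterE.
have -> /= : dec chain_code y = (odflt w10 [pick w | phi1 w == phi1 w1],
                              odflt w20 [pick w | phi2 w == phi2 w2]).
  rewrite /=; congr (odflt _ _, odflt _ _); apply: eq_pick => w; congr (_ == _);
    by apply/ffunP => b; rewrite ffunE curE.
congr (_, _); case: pickP => [w /eqP|/(_ _)] //=.
- by move/phi1_inj.
- by move=> /(_ w1); rewrite eqxx.
- by move/phi2_inj.
- by move=> /(_ w2); rewrite eqxx.
Qed.

Variables (PS : fdist R (S1 * S2)%type) (W : X1 -> X2 -> S1 -> S2 -> fdist R Y).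

Definition fail_at (b : nat) (s : {ffun 'I_N -> S1 * S2}) (y : {ffun 'I_N -> Y}) : R :=
  block_fail R (@fst_word 'I_n S1 S2) (@snd_word 'I_n S1 S2) sc (prev b) (cur b)
    (block (s10, s20) n s b) (block y0 n y b).

Lemma fail_at_ge0 b s y : 0 <= fail_at b s y.
Proof. by rewrite /fail_at /block_fail !addr_ge0. Qed.

Lemma fst_word_block (s : {ffun 'I_N -> S1 * S2}) b : (b <= B)%N ->
  fst_word (block (s10, s20) n s b) = block s10 n (fst_word s) b.
Proof.
move=> bB; apply/ffunP => i; rewrite !ffunE.
by rewrite (_ : b * n + i = Ordinal (block_pos_lt i nBN bB))%N // !letterE ffunE.
Qed.

Lemma snd_word_block (s : {ffun 'I_N -> S1 * S2}) b : (b <= B)%N ->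
  snd_word (block (s10, s20) n s b) = block s20 n (snd_word s) b.
Proof.
move=> bB; apply/ffunP => i; rewrite !ffunE.
by rewrite (_ : b * n + i = Ordinal (block_pos_lt i nBN bB))%N // !letterE ffunE.
Qed.

(** If all estimates are right on the words of the genie, uniqueness identifies these with the
    transmitted words, and only [bdec] can fail. Otherwise a wrong estimate is determined by the
    states alone: the right side is at least 1 whatever the output, and the two channel laws need
    not be compared. *)
Lemma error_given_state (s : {ffun 'I_N -> S1 * S2}) :
  \sum_(x1 : {ffun 'I_N -> X1})
    \sum_(x2 : {ffun 'I_N -> X2} |
        transmitted chain_code w1 w2 (fst_word s) (snd_word s) x1 x2)
      \sum_(y : {ffun 'I_N -> Y} | dec chain_code y != (w1, w2))
        \prod_(i < N) W (x1 i) (x2 i) (fst_word s i) (snd_word s i) (y i) <=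
  Ex (channel_law W (genie1 (fst_word s)) (genie2 (snd_word s)) s)
    (fun y => \sum_(b < B.+1) fail_at b s y).
Proof.
have [[z1 z2] [/= zT z_uniq]] :=
  transmitted_unique chain_code w1 w2 (fst_word s) (snd_word s).
rewrite (bigD1 z1) //= (bigD1 z2) //= [X in _ + X + _]big1 => [|x2 /andP[xT x2z]]; last first.
  by have [x2E] := z_uniq (z1, x2) xT; rewrite x2E eqxx in x2z.
rewrite addr0 [X in _ + X]big1 => [|x1 x1z]; last first.
  apply: big1 => x2 xT.
  by have [x1E _] := z_uniq (x1, x2) xT; rewrite x1E eqxx in x1z.
rewrite addr0.
have lhsE : \sum_(y : {ffun 'I_N -> Y} | dec chain_code y != (w1, w2))
    \prod_(i < N) W (z1 i) (z2 i) (fst_word s i) (snd_word s i) (y i) =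
    Ex (channel_law W z1 z2 s) (fun y => (dec chain_code y != (w1, w2))%:R).
  rewrite big_mkcond; apply: eq_bigr => y _ /=.
  case: (_ != _); rewrite ?mulr0 // mulr1.
  by apply: eq_bigr => i _; rewrite !ffunE.
rewrite lhsE {lhsE}.
pose ok := [forall b : 'I_B.+1,
  (est1 sc (prev b) (block s20 n (snd_word s) b) (block x10 n (genie1 (fst_word s)) b)
     == cur1 w1 b) &&
  (est2 sc (prev b) (block s10 n (fst_word s) b) (block x20 n (genie2 (snd_word s)) b)
     == cur2 w2 b)].
have [/forallP okb|] := boolP ok.
  have gT : transmitted chain_code w1 w2 (fst_word s) (snd_word s)
      (genie1 (fst_word s)) (genie2 (snd_word s)).
    apply: transmitted_genie => b bB.
    by have /andP[/eqP -> /eqP ->] := okb (Ordinal (bB : (b < B.+1)%N)).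
  have [z1E z2E] := z_uniq (_, _) gT; rewrite -{}z1E -{}z2E {zT z_uniq}.
  apply: Ex_le => y _; case: eqP => [_|/eqP dec_bad].
    by apply: sumr_ge0 => b _; exact: fail_at_ge0.
  have [b bad] : exists b : 'I_B.+1, bdec sc (cur b) (block y0 n y b) != prev b.
    apply: contrapT => /forallNP good; case/eqP: dec_bad.
    apply: dec_genie => b bB; apply/eqP/negPn/negP.
    exact: (good (Ordinal (bB : (b < B.+1)%N))).
  rewrite (bigD1 b) //= ler_wpDr ?sumr_ge0 // => [b' _|]; first exact: fail_at_ge0.
  by rewrite /fail_at /block_fail bad lerDr addr_ge0.
rewrite negb_forall => /existsP[b bad].
apply: (@le_trans _ _ 1).
  by apply: Ex_le_cst => y _; case: (_ != _).
apply: Ex_ge_cst => y _.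
rewrite (bigD1 b) //= ler_wpDr ?sumr_ge0 // => [b' _|]; first exact: fail_at_ge0.
have bB : (b <= B)%N by rewrite -ltnS.
rewrite /fail_at /block_fail fst_word_block // snd_word_block //.
rewrite -block_genie1 // -block_genie2 // ler_wpDr //.
by move: bad; rewrite negb_and; case: (_ != _) => /= [_|->]; rewrite ?lerDl ?lerDr.
Qed.

(** A block sent with the genie depends on the states of that block only, so the marginals of the
    product laws at its positions describe an isolated block. *)
Lemma Ex_fail_at b : (b <= B)%N ->
  Ex (state_law PS 'I_N) (fun s =>
    Ex (channel_law W (genie1 (fst_word s)) (genie2 (snd_word s)) s) (fail_at b s)) =
  block_error (@fst_word 'I_n S1 S2) (@snd_word 'I_n S1 S2) (state_law PS 'I_n)
    (fun x1 x2 => channel_law W x1 x2) sc (prev b) (cur b).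
Proof.
move=> bB.
pose h (i : 'I_n) : 'I_N := Ordinal (block_pos_lt i nBN bB).
have h_inj : injective h by move=> i i' [] /addnI /val_inj.
have blockE (A : finType) (a0 : A) (x : {ffun 'I_N -> A}) :
    block a0 n x b = [ffun i => x (h i)].
  by apply/ffunP => i; rewrite !ffunE -(letterE a0 x).
rewrite /block_error /state_law -(Ex_inj_marginal (fun=> PS) _ h_inj).
apply: Ex_ext => s; rewrite /fail_at blockE.
under Ex_ext do rewrite blockE.
rewrite (Ex_inj_marginal _ (fun y => block_fail R _ _ _ _ _ _ y) h_inj).
apply: Ex_law => y /=; apply: eq_bigr => i _.
have -> : [ffun i => s (h i)] = block (s10, s20) n s b by rewrite blockE.
rewrite fst_word_block // snd_word_block // -block_genie1 // -block_genie2 //.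
by rewrite !blockE !ffunE.
Qed.

Theorem chain_error :
  error_given PS W chain_code w1 w2 <=
  \sum_(b < B.+1) block_error (@fst_word 'I_n S1 S2) (@snd_word 'I_n S1 S2)
    (state_law PS 'I_n) (fun x1 x2 => channel_law W x1 x2) sc (prev b) (cur b).
Proof.
rewrite /error_given sum_states.
apply: le_trans (Ex_le (fun s _ => error_given_state s)) _.
under Ex_ext do rewrite Ex_sum.
by rewrite Ex_sum; apply: ler_sum => b _; rewrite Ex_fail_at // -ltnS.
Qed.

End FixedMessages.

End Chain.

(** * Typical words *)

Section Typicality.
Variable R : realType.

Lemma ln2_gt0 : 0 < ln 2 :> R.
Proof. by rewrite ln_gt0 // ltr1n. Qed.

Lemma ler_pow2 (x y : R) : (2 `^ x <= 2 `^ y) = (x <= y).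
Proof. by rewrite /powR gt_eqF // ler_expR ler_pM2r ?ln2_gt0. Qed.

Lemma ltr_pow2 (x y : R) : (2 `^ x < 2 `^ y) = (x < y).
Proof. by rewrite !ltNge ler_pow2. Qed.

Lemma powR_log2_prod (I : finType) (r : I -> R) : (forall i, 0 < r i) ->
  \prod_i r i = 2 `^ (\sum_i log2 (r i)).
Proof.
move=> r0; rewrite /powR gt_eqF // -mulr_suml divfK ?gt_eqF ?ln2_gt0 //.
rewrite expR_sum; apply: eq_bigr => i _; by rewrite lnK ?posrE.
Qed.

(** Weakens exponentially small terms to the order 1/n of Chebyshev's bound, so that one constant
    controls them all. *)
Lemma powR_inv_le (x : R) : 0 < x -> 2 `^ (- x) <= (x * ln 2)^-1.
Proof.
move=> x0; have xl : 0 < x * ln 2 by rewrite mulr_gt0 ?ln2_gt0.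
rewrite powRN lef_pV2 ?posrE ?powR_gt0 // /powR gt_eqF //.
by apply: le_trans (expR_ge1Dx _); rewrite lerDr.
Qed.

Section Chebyshev.
Variables (Om : finType) (P : fdist R Om).

Definition variance (f : Om -> R) : R := Ex P (fun w => (f w - Ex P f) ^+ 2).

Lemma deviation_ind (z e : R) (b : bool) : 0 < e -> (b -> e <= `|z|) ->
  b%:R <= z ^+ 2 / e ^+ 2.
Proof.
move=> e0; case: b => [/(_ isT) ez|_]; last by rewrite divr_ge0 ?sqr_ge0.
rewrite ler_pdivlMr ?exprn_gt0 // mul1r -[z ^+ 2]real_normK ?num_real //.
by rewrite lerXn2r ?nnegrE // ltW.
Qed.

(** The deviation is required only on words of positive probability, where the ratios are positive
    and their logarithms meaningful. *)
Lemma chebyshev_word (n : nat) (f : Om -> R) (g : R) (b : {ffun 'I_n -> Om} -> bool) :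
  (0 < n)%N -> 0 < g ->
  (forall c : {ffun 'I_n -> Om}, (forall i, P (c i) != 0) -> b c ->
    n%:R * g <= `|\sum_i f (c i) - n%:R * Ex P f|) ->
  Ex (prodf (fun _ : 'I_n => P)) (fun c => (b c)%:R) <= variance f / (n%:R * g ^+ 2).
Proof.
move=> n0 g0 bdev; have n_gt0 : 0 < n%:R :> R by rewrite ltr0n.
apply: (@le_trans _ _ (Ex (prodf (fun _ : 'I_n => P)) (fun c =>
    (\sum_i (f (c i) - Ex P f)) ^+ 2 / (n%:R * g) ^+ 2))).
  apply: Ex_le => c Pc; apply: deviation_ind; first by rewrite mulr_gt0.
  move=> bc; apply: le_trans (bdev c _ bc) _.
    by move=> i; exact: prodf_neq0 Pc.
  by rewrite big_split /= sumr_const card_ord mulNrn mulr_natl.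
rewrite ExZr (second_moment (Q := fun=> P) (h := id) (g := fun _ w => f w - Ex P f)) //.
  rewrite sumr_const card_ord -/(variance f) -[X in X / _]mulr_natl.
  by rewrite le_eqVlt; apply/orP; left; apply/eqP; field; rewrite !gt_eqF.
by move=> j; rewrite ExB Ex_cst subrr.
Qed.

Variables (n : nat) (r : Om -> R) (g : R).
Hypotheses (r_gt0 : forall w, P w != 0 -> 0 < r w) (n_gt0 : (0 < n)%N) (g_gt0 : 0 < g).
Let mu := Ex P (fun w => log2 (r w)).
Let V := variance (fun w => log2 (r w)) / (n%:R * g ^+ 2).

Lemma typical_upper :
  Ex (prodf (fun _ : 'I_n => P))
    (fun c => (2 `^ (n%:R * (mu + g)) < \prod_i r (c i))%R%:R) <= V.
Proof.
apply: chebyshev_word => // c Pc.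
rewrite powR_log2_prod => [|i]; last exact: r_gt0.
rewrite ltr_pow2 => /ltW h.
by apply: le_trans (ler_norm _); rewrite -/mu; lra.
Qed.

Lemma typical_lower :
  Ex (prodf (fun _ : 'I_n => P))
    (fun c => (\prod_i r (c i) <= 2 `^ (n%:R * (mu - g)))%R%:R) <= V.
Proof.
apply: chebyshev_word => // c Pc.
rewrite powR_log2_prod => [|i]; last exact: r_gt0.
rewrite ler_pow2 => h.
by rewrite distrC; apply: le_trans (ler_norm _); rewrite -/mu; lra.
Qed.

End Chebyshev.

Lemma lratio_word (n : nat) (V A : finType) (Q : 'I_n -> fdist R V)
    (p : 'I_n -> fdist R (A * V)%type) (b : {ffun 'I_n -> V}) :
  lratio (prodf Q) (prodf p) (@snd_word 'I_n A V) b =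
  \prod_i lratio (Q i) (p i) snd (b i).
Proof.
rewrite /lratio.
under [RHS]eq_bigr do rewrite big_mkcond.
rewrite bigA_distr_bigA /= [LHS]big_mkcond; apply: eq_bigr => a _.
case: eqP => [<-|ab].
  rewrite /prodf_val -prodf_div; apply: eq_bigr => i _.
  by rewrite ffunE eqxx.
have [i ai] : exists i, (a i).2 != b i.
  apply: contrapT => /forallNP all_eq; apply: ab; apply/ffunP => i.
  by rewrite ffunE; apply/eqP/negPn/negP/all_eq.
by rewrite (bigD1 i) //= (negPf ai) mul0r.
Qed.

(** Nonnegativity of a divergence, from ln x <= x - 1 at the inverse ratio and a change of measure.
    It keeps the bin exponents nonnegative, as [bins_upper] requires. *)
Lemma log2_lratio_ge0 (V A : finType) (Q : fdist R V) (p : fdist R A) (v : A -> V) :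
  (forall a, Q (v a) = 0 -> p a = 0) ->
  0 <= Ex p (fun a => log2 (lratio Q p v (v a))).
Proof.
move=> abs.
have lr_gt0 a : p a != 0 -> 0 < lratio Q p v (v a).
  move=> pa; rewrite /lratio (bigD1 a) //= ltr_wpDr //.
    by apply: sumr_ge0 => b _; rewrite divr_ge0 ?fdist_ge0.
  by rewrite divr_gt0 // lt_def fdist_ge0 andbT //; apply: contra pa => /eqP/abs ->.
rewrite -oppr_le0 -ExN.
apply: (@le_trans _ _ (Ex p (fun a => ((lratio Q p v (v a))^-1 - 1) / ln 2))).
  apply: Ex_le => a /lr_gt0 l0; rewrite /log2 -mulNr ler_wpM2r ?invr_ge0 ?(ltW ln2_gt0) //.
  by rewrite -lnV ?posrE // -[X in ln X](subrK 1) addrC le_ln1Dx // ltrBrDl subrr; rewrite invr_gt0.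
rewrite ExZr ExB Ex_cst -(Ex_lratio abs (fun x => (lratio Q p v x)^-1)).
rewrite mulr_le0_ge0 ?invr_ge0 ?(ltW ln2_gt0) // subr_le0.
apply: Ex_le_cst => x _.
by have [->|l0] := eqVneq (lratio Q p v x) 0; rewrite ?mul0r ?ler01 ?divff.
Qed.

End Typicality.

(** * Information densities *)

Section Information.
Variables (R : realType) (Om : finType) (P : fdist R Om).

Lemma lawE (A : finType) (X : Om -> A) (a : A) :
  law P X a = Ex P (fun w => (X w == a)%:R).
Proof. by rewrite /law big_mkcond; apply: eq_bigr => w _; case: eqP; rewrite ?mulr1 ?mulr0. Qed.

Lemma law_ge0 (A : finType) (X : Om -> A) (a : A) : 0 <= law P X a.
Proof. by apply: sumr_ge0 => w _; rewrite fdist_ge0. Qed.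

Lemma law_gt0 (A : finType) (X : Om -> A) w : P w != 0 -> 0 < law P X (X w).
Proof.
move=> Pw; rewrite /law (bigD1 w) //= ltr_wpDr //; last by rewrite lt_def Pw fdist_ge0.
by apply: sumr_ge0 => w' _; rewrite fdist_ge0.
Qed.

Lemma sum_law (A : finType) (X : Om -> A) (g : A -> R) :
  \sum_a law P X a * g a = Ex P (fun w => g (X w)).
Proof.
rewrite /Ex [RHS](partition_big X predT) //=; apply: eq_bigr => a _.
by rewrite /law mulr_suml; apply: eq_bigr => w /eqP ->.
Qed.

Lemma mutual_infoE (A B : finType) (X : Om -> A) (Z : Om -> B) :
  mutual_info P X Z = Ex P (fun w =>
    log2 (law P (rvpair X Z) (X w, Z w) / (law P X (X w) * law P Z (Z w)))).
Proof.
rewrite -(sum_law (rvpair X Z) (fun c => log2 (law P (rvpair X Z) (c.1, c.2) /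
  (law P X c.1 * law P Z c.2)))) /=.
by rewrite sum_pair.
Qed.

Lemma cond_mutual_infoE (A B C : finType) (X : Om -> A) (V : Om -> B) (Z : Om -> C) :
  cond_mutual_info P X V Z = Ex P (fun w =>
    log2 (law P (rvpair (rvpair X V) Z) (X w, V w, Z w) * law P Z (Z w) /
      (law P (rvpair X Z) (X w, Z w) * law P (rvpair V Z) (V w, Z w)))).
Proof.
rewrite -(sum_law (rvpair (rvpair X V) Z)
  (fun c => log2 (law P (rvpair (rvpair X V) Z) (c.1.1, c.1.2, c.2) * law P Z c.2 /
  (law P (rvpair X Z) (c.1.1, c.2) * law P (rvpair V Z) (c.1.2, c.2))))) /=.
by rewrite !sum_pair; apply: eq_bigr => a _; apply: eq_bigr => b _.
Qed.

Lemma log2B (x y : R) : 0 < x -> 0 < y -> log2 x - log2 y = log2 (x / y).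
Proof. by move=> x0 y0; rewrite /log2 ln_div ?posrE // mulrBl. Qed.

Variables (A B C D : finType) (X : Om -> A) (V : Om -> B) (S : Om -> C) (Z : Om -> D).
Variable p : Om -> R.
Hypothesis lawVSZ : forall w, P w != 0 ->
  law P (rvpair (rvpair V S) Z) (V w, S w, Z w) =
  law P (rvpair S Z) (S w, Z w) * p w.

Lemma density_gt0 w : P w != 0 -> 0 < p w.
Proof.
move=> Pw; have := law_gt0 (rvpair (rvpair V S) Z) Pw.
by rewrite [law _ _ _]lawVSZ // pmulr_rgt0 // (law_gt0 (rvpair S Z)).
Qed.

(** The law of [V] given [Z] cancels between the two informations; what remains below the fraction
    is [p], the conditional law of [V] given [S] and [Z]. *)
Lemma cond_mutual_info_diff :
  cond_mutual_info P X V Z - cond_mutual_info P V S Z = Ex P (fun w =>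
    log2 (law P (rvpair (rvpair X V) Z) (X w, V w, Z w) /
      (law P (rvpair X Z) (X w, Z w) * p w))).
Proof.
rewrite !cond_mutual_infoE -ExB; apply: Ex_eq => w Pw; rewrite lawVSZ //.
have p0 := density_gt0 Pw.
have := law_gt0 (rvpair (rvpair X V) Z) Pw; have := law_gt0 (rvpair X Z) Pw.
have := law_gt0 (rvpair V Z) Pw; have := law_gt0 (rvpair S Z) Pw.
have := law_gt0 Z Pw; rewrite /rvpair.
move: (law _ _ _) (law _ _ _) (law _ _ _) (law _ _ _) (law _ _ _) (p w) p0.
move=> a b c d e q q0 a0 b0 c0 d0 e0.
rewrite log2B ?divr_gt0 ?mulr_gt0 //; congr log2; field.
by rewrite !gt_eqF.
Qed.

Lemma mutual_info_diff :
  mutual_info P X (rvpair V Z) - cond_mutual_info P V S Z = Ex P (fun w =>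
    log2 (law P (rvpair X (rvpair V Z)) (X w, (V w, Z w)) /
      (law P X (X w) * law P Z (Z w) * p w))).
Proof.
rewrite mutual_infoE cond_mutual_infoE -ExB; apply: Ex_eq => w Pw; rewrite lawVSZ //.
have p0 := density_gt0 Pw.
have := law_gt0 (rvpair X (rvpair V Z)) Pw; have := law_gt0 X Pw.
have := law_gt0 (rvpair V Z) Pw; have := law_gt0 (rvpair S Z) Pw.
have := law_gt0 Z Pw; rewrite /rvpair.
move: (law _ _ _) (law _ _ _) (law _ _ _) (law _ _ _) (law _ _ _) (p w) p0.
move=> a b c d e q q0 a0 b0 c0 d0 e0.
rewrite log2B ?divr_gt0 ?mulr_gt0 //; congr log2; field.
by rewrite !gt_eqF.
Qed.

End Information.

Section Push.
Variables (R : realType) (A B : finType) (P : fdist R A) (f : A -> B).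

Lemma push_sum1 : \sum_b law P f b = 1.
Proof. by have := sum_law P f (fun=> 1); rewrite Ex_cst => <-; apply: eq_bigr => b _; rewrite mulr1. Qed.

Definition push : fdist R B := FDist (law_ge0 P f) push_sum1.

End Push.

(** * Single-letter laws and the densities of the three rate bounds *)

Section SingleLetter.
Variables (R : realType) (X1 X2 S1 S2 Y U V1 V2 : finType).
Variables (PS : fdist R (S1 * S2)%type) (W : X1 -> X2 -> S1 -> S2 -> fdist R Y).
Variables (PU : fdist R U).

(** The law of V given U = u, obtained by averaging over the states, which are independent of U. *)
Definition aux_law (X V S : finType) (p : U -> S -> fdist R (X * V)%type)
    (sg : S1 * S2 -> S) (u : U) : fdist R V :=
  push (bind PS (fun s => p u (sg s))) (fun c => c.2.2).

Lemma aux_law_abs_cont (X V S : finType) (p : U -> S -> fdist R (X * V)%type)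
    (sg : S1 * S2 -> S) u s a :
  PS s != 0 -> aux_law p sg u a.2 = 0 -> p u (sg s) a = 0.
Proof.
move=> PSs; apply: contra_eq => pa; rewrite gt_eqF //=.
by apply: (law_gt0 (fun c : S1 * S2 * (X * V) => c.2.2) (w := (s, a))); rewrite /= /bind_val /= mulf_neq0.
Qed.

Variables (P1 : U -> S1 -> fdist R (X1 * V1)%type).
Variables (P2 : U -> S2 -> fdist R (X2 * V2)%type).

Definition source_law : fdist R (U * (S1 * S2))%type := bind PU (fun=> PS).
Definition source1_law : fdist R (U * (S1 * S2) * (X1 * V1))%type :=
  bind source_law (fun c => P1 c.1 c.2.1).
Definition input_law : fdist R (U * (S1 * S2) * (X1 * V1) * (X2 * V2))%type :=
  bind source1_law (fun c => P2 c.1.1 c.1.2.2).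
(** The joint distribution in order of generation, so that expectations unfold into successive draws
    and match [Ejoint]. *)
Definition letter_law : fdist R (U * (S1 * S2) * (X1 * V1) * (X2 * V2) * Y)%type :=
  bind input_law (fun c => W c.1.2.1 c.2.1 c.1.1.2.1 c.1.1.2.2).

Definition to_joint (c : U * (S1 * S2) * (X1 * V1) * (X2 * V2) * Y) :
    joint_alphabet X1 X2 S1 S2 Y U V1 V2 :=
  let: (u, (s1, s2), (x1, v1), (x2, v2), y) := c in (s1, s2, u, v1, v2, x1, x2, y).

Definition of_joint (w : joint_alphabet X1 X2 S1 S2 Y U V1 V2) :
    U * (S1 * S2) * (X1 * V1) * (X2 * V2) * Y :=
  let: (s1, s2, u, v1, v2, x1, x2, y) := w in (u, (s1, s2), (x1, v1), (x2, v2), y).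

Lemma to_jointK : cancel to_joint of_joint.
Proof. by move=> [[[[? [? ?]] [? ?]] [? ?]] ?]. Qed.

Lemma of_jointK : cancel of_joint to_joint.
Proof. by move=> [[[[[[[? ?] ?] ?] ?] ?] ?] ?]. Qed.

Variable P : fdist R (joint_alphabet X1 X2 S1 S2 Y U V1 V2).
Hypothesis P_joint : forall s1 s2 u v1 v2 x1 x2 y,
  P (s1, s2, u, v1, v2, x1, x2, y) =
  PS (s1, s2) * PU u * P1 u s1 (x1, v1) * P2 u s2 (x2, v2) * W x1 x2 s1 s2 y.

Lemma P_to_joint c : P (to_joint c) = letter_law c.
Proof.
case: c => [[[[u [s1 s2]] [x1 v1]] [x2 v2]] y] /=.
by rewrite P_joint /bind_val /= /bind_val /= /bind_val /= /bind_val /= [PU u * _]mulrC.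
Qed.

Lemma Ex_to_joint f : Ex P f = Ex letter_law (fun c => f (to_joint c)).
Proof.
rewrite /Ex (reindex to_joint) /=; last first.
  by exists of_joint => ? _; [exact: to_jointK|exact: of_jointK].
by apply: eq_bigr => c _; rewrite P_to_joint.
Qed.

Lemma Ex_joint f : Ex P f =
  Ex PU (fun u => Ex PS (fun s => Ex (P1 u s.1) (fun a => Ex (P2 u s.2) (fun b =>
    Ex (W a.1 b.1 s.1 s.2) (fun y => f (to_joint (u, s, a, b, y))))))).
Proof.
by rewrite Ex_to_joint /letter_law /input_law /source1_law /source_law !Ex_bind.
Qed.

Lemma Ex_delta (A : finType) (p : fdist R A) (a0 : A) (g : A -> R) :
  Ex p (fun a => (a == a0)%:R * g a) = p a0 * g a0.
Proof.
rewrite /Ex (bigD1 a0) //= eqxx mul1r big1 ?addr0 // => a /negPf ->.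
by rewrite mul0r mulr0.
Qed.

(** Once u and both states are pinned, the factorization splits into independent draws of the two
    users. *)
Lemma Ex_joint_at f u s g :
  (forall u' s' a b y, f (to_joint (u', s', a, b, y)) =
     (u' == u)%:R * ((s' == s)%:R * g a b)) ->
  Ex P f = PU u * (PS s * Ex (P1 u s.1) (fun a => Ex (P2 u s.2) (g a))).
Proof.
move=> fE; rewrite Ex_joint.
rewrite -(Ex_delta PS s (fun s => Ex (P1 u s.1) (fun a => Ex (P2 u s.2) (g a)))).
rewrite -(Ex_delta PU u (fun u => Ex PS (fun s' => (s' == s)%:R *
  Ex (P1 u s'.1) (fun a => Ex (P2 u s'.2) (g a))))).
apply: Ex_ext => u'; rewrite -ExZ; apply: Ex_ext => s'; rewrite mulrA -ExZ.
apply: Ex_ext => a; rewrite -ExZ; apply: Ex_ext => b.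
by under Ex_ext do rewrite fE; rewrite Ex_cst mulrA.
Qed.

Definition second_law (A V : finType) (p : fdist R (A * V)%type) (v : V) : R :=
  Ex p (fun a => (a.2 == v)%:R).

Local Notation rS1 := (@rvS1 X1 X2 S1 S2 Y U V1 V2).
Local Notation rS2 := (@rvS2 X1 X2 S1 S2 Y U V1 V2).
Local Notation rU := (@rvU X1 X2 S1 S2 Y U V1 V2).
Local Notation rV1 := (@rvV1 X1 X2 S1 S2 Y U V1 V2).
Local Notation rV2 := (@rvV2 X1 X2 S1 S2 Y U V1 V2).
Local Notation rX1 := (@rvX1 X1 X2 S1 S2 Y U V1 V2).
Local Notation rX2 := (@rvX2 X1 X2 S1 S2 Y U V1 V2).
Local Notation rY := (@rvY X1 X2 S1 S2 Y U V1 V2).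

Lemma law_S1_US2 s1 u s2 :
  law P (rvpair rS1 (rvpair rU rS2)) (s1, (u, s2)) = PU u * PS (s1, s2).
Proof.
rewrite lawE (Ex_joint_at (u := u) (s := (s1, s2)) (g := fun _ _ => 1)) => [|u' [? ?] [? ?] [? ?] y].
  by rewrite !(Ex_cst, mulr1).
rewrite mulr1 /= !xpair_eqE -natrM mulnb; congr (nat_of_bool _)%:R.
by rewrite andbCA.
Qed.

Lemma law_S2_US1 s2 u s1 :
  law P (rvpair rS2 (rvpair rU rS1)) (s2, (u, s1)) = PU u * PS (s1, s2).
Proof.
rewrite lawE (Ex_joint_at (u := u) (s := (s1, s2)) (g := fun _ _ => 1)) => [|u' [? ?] [? ?] [? ?] y].
  by rewrite !(Ex_cst, mulr1).
rewrite mulr1 /= !xpair_eqE -natrM mulnb; congr (nat_of_bool _)%:R.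
by rewrite andbC -andbA.
Qed.

Lemma law_S_U s1 s2 u :
  law P (rvpair (rvpair rS1 rS2) rU) (s1, s2, u) = PU u * PS (s1, s2).
Proof.
rewrite lawE (Ex_joint_at (u := u) (s := (s1, s2)) (g := fun _ _ => 1)) => [|u' [? ?] [? ?] [? ?] y].
  by rewrite !(Ex_cst, mulr1).
rewrite mulr1 /= !xpair_eqE -natrM mulnb; congr (nat_of_bool _)%:R.
by rewrite andbC.
Qed.

Lemma law_U u : law P rU u = PU u.
Proof.
rewrite lawE Ex_joint -[RHS]mulr1 -(Ex_delta PU u (fun=> 1)).
apply: Ex_ext => u'; rewrite mulr1 -[RHS](Ex_cst PS); apply: Ex_ext => s.
rewrite -[RHS](Ex_cst (P1 u' s.1)); apply: Ex_ext => a.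
rewrite -[RHS](Ex_cst (P2 u' s.2)); apply: Ex_ext => b.
rewrite -[RHS](Ex_cst (W a.1 b.1 s.1 s.2)); apply: Ex_ext => y.
by case: s a b => [? ?] [? ?] [? ?].
Qed.

(** The Markov chain V1 - (U, S1) - S2. *)
Lemma law_V1_S1_US2 v s1 u s2 :
  law P (rvpair (rvpair rV1 rS1) (rvpair rU rS2)) (v, s1, (u, s2)) =
  law P (rvpair rS1 (rvpair rU rS2)) (s1, (u, s2)) * second_law (P1 u s1) v.
Proof.
rewrite law_S1_US2 lawE (Ex_joint_at (u := u) (s := (s1, s2)) (g := fun a _ => (a.2 == v)%:R)).
  by under Ex_ext do rewrite Ex_cst; rewrite mulrA.
move=> u' [? ?] [? ?] [? ?] y /=.
rewrite !xpair_eqE -!natrM !mulnb; congr (nat_of_bool _)%:R.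
by do ?case: (_ == _).
Qed.

Lemma law_V2_S2_US1 v s2 u s1 :
  law P (rvpair (rvpair rV2 rS2) (rvpair rU rS1)) (v, s2, (u, s1)) =
  law P (rvpair rS2 (rvpair rU rS1)) (s2, (u, s1)) * second_law (P2 u s2) v.
Proof.
rewrite law_S2_US1 lawE (Ex_joint_at (u := u) (s := (s1, s2)) (g := fun _ b => (b.2 == v)%:R)).
  by rewrite Ex_cst mulrA.
move=> u' [? ?] [? ?] [? ?] y /=.
rewrite !xpair_eqE -!natrM !mulnb; congr (nat_of_bool _)%:R.
by do ?case: (_ == _).
Qed.

(** Given U and both states, V1 and V2 are independent. *)
Lemma law_V_S_U v1 v2 s1 s2 u :
  law P (rvpair (rvpair (rvpair rV1 rV2) (rvpair rS1 rS2)) rU) (v1, v2, (s1, s2), u) =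
  law P (rvpair (rvpair rS1 rS2) rU) (s1, s2, u) *
  (second_law (P1 u s1) v1 * second_law (P2 u s2) v2).
Proof.
rewrite law_S_U lawE (Ex_joint_at (u := u) (s := (s1, s2))
  (g := fun a b => (a.2 == v1)%:R * (b.2 == v2)%:R)).
  by under Ex_ext do rewrite ExZ; rewrite ExZr mulrA.
move=> u' [? ?] [? ?] [? ?] y /=.
rewrite !xpair_eqE -!natrM !mulnb; congr (nat_of_bool _)%:R.
by do ?case: (_ == _).
Qed.

Local Notation Q1 := (aux_law P1 fst).
Local Notation Q2 := (aux_law P2 snd).

(* The ratios p(v | u, x, s) / p(v | u), and p(u, v1, v2 | y) / p(u, v1, v2) under
   independent v1, v2 given u; where a denominator vanishes they are 0, which keeps
   their expectations below 1. *)
Definition ratio1 u v x s2 : R :=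
  law P (rvpair (rvpair rX1 rV1) (rvpair rU rS2)) (x, v, (u, s2)) /
  (law P (rvpair rX1 (rvpair rU rS2)) (x, (u, s2)) * Q1 u v).
Definition ratio2 u v x s1 : R :=
  law P (rvpair (rvpair rX2 rV2) (rvpair rU rS1)) (x, v, (u, s1)) /
  (law P (rvpair rX2 (rvpair rU rS1)) (x, (u, s1)) * Q2 u v).
Definition ratioY u v1 v2 y : R :=
  law P (rvpair rY (rvpair (rvpair rV1 rV2) rU)) (y, (v1, v2, u)) /
  (law P rY y * PU u * (Q1 u v1 * Q2 u v2)).

Lemma ratio1_ge0 u v x s : 0 <= ratio1 u v x s.
Proof. by rewrite /ratio1 divr_ge0 ?mulr_ge0 ?fdist_ge0 ?law_ge0. Qed.

Lemma ratio2_ge0 u v x s : 0 <= ratio2 u v x s.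
Proof. by rewrite /ratio2 divr_ge0 ?mulr_ge0 ?fdist_ge0 ?law_ge0. Qed.

Lemma ratioY_ge0 u v1 v2 y : 0 <= ratioY u v1 v2 y.
Proof. by rewrite /ratioY divr_ge0 ?mulr_ge0 ?fdist_ge0 ?law_ge0. Qed.

Lemma sum_law_pair (Om A B : finType) (p : fdist R Om) (X : Om -> A) (Z : Om -> B) a :
  \sum_b law p (rvpair X Z) (a, b) = law p X a.
Proof.
under eq_bigr do rewrite lawE; rewrite -Ex_sum lawE; apply: Ex_ext => w.
rewrite (bigD1 (Z w)) //= big1 ?addr0 => [|b bZ]; rewrite xpair_eqE ?eqxx ?andbT //.
by rewrite [Z w == b]eq_sym (negPf bZ) andbF.
Qed.

Lemma sum_law_triple (Om A B C : finType) (p : fdist R Om) (X : Om -> A) (V : Om -> B)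
    (Z : Om -> C) a c :
  \sum_b law p (rvpair (rvpair X V) Z) (a, b, c) = law p (rvpair X Z) (a, c).
Proof.
under eq_bigr do rewrite lawE; rewrite -Ex_sum lawE; apply: Ex_ext => w.
rewrite (bigD1 (V w)) //= big1 ?addr0 => [|b bV]; rewrite !xpair_eqE ?eqxx ?andbT //.
by rewrite [V w == b]eq_sym (negPf bV) andbF.
Qed.

Lemma mulr_ratio_le (a b c : R) : 0 <= b -> 0 <= c -> a * (b / (c * a)) <= b / c.
Proof.
move=> b0 c0; have [->|a0] := eqVneq a 0; first by rewrite mul0r divr_ge0.
rewrite invfM mulrCA [a * _]mulrC -mulrA mulVf // mulr1 //.
Qed.

Lemma divff_le1 (a : R) : a / a <= 1.
Proof. by have [->|a0] := eqVneq a 0; rewrite ?mul0r ?ler01 ?divff. Qed.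

Lemma Ex_ratio1 u x s : Ex (Q1 u) (fun v => ratio1 u v x s) <= 1.
Proof.
apply: le_trans (divff_le1 (law P (rvpair rX1 (rvpair rU rS2)) (x, (u, s)))).
rewrite -{1}(sum_law_triple P rX1 rV1) mulr_suml.
by apply: ler_sum => v _; apply: mulr_ratio_le; rewrite law_ge0.
Qed.

Lemma Ex_ratio2 u x s : Ex (Q2 u) (fun v => ratio2 u v x s) <= 1.
Proof.
apply: le_trans (divff_le1 (law P (rvpair rX2 (rvpair rU rS1)) (x, (u, s)))).
rewrite -{1}(sum_law_triple P rX2 rV2) mulr_suml.
by apply: ler_sum => v _; apply: mulr_ratio_le; rewrite law_ge0.
Qed.

Lemma Ex_ratioY y :
  Ex PU (fun u => Ex (Q1 u) (fun v => Ex (Q2 u) (fun v' => ratioY u v v' y))) <= 1.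
Proof.
apply: le_trans (divff_le1 (law P rY y)).
rewrite -{1}(sum_law_pair P rY (rvpair (rvpair rV1 rV2) rU)) mulr_suml.
rewrite sum_pair exchange_big /=; apply: ler_sum => u _.
rewrite sum_pair /= mulr_sumr; apply: ler_sum => v _.
rewrite !mulr_sumr; apply: ler_sum => v' _; rewrite /ratioY.
set L := law _ _ (y, _).
rewrite (_ : _ * _ = (PU u * (Q1 u v * Q2 u v')) *
   (L / (law P rY y * (PU u * (Q1 u v * Q2 u v'))))); last by rewrite !mulrA.
by apply: mulr_ratio_le; exact: law_ge0.
Qed.

Local Notation letters := (U * (S1 * S2) * (X1 * V1) * (X2 * V2) * Y)%type.
Implicit Type c : letters.

(** The mean of log2 is I(V1; X1, S2 | U) for [dens1], I(Y; V1, V2, U) + I(V1; V2 | U) for [densY],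
    and I(V1; S1 | U) for [bin1]. *)
Definition dens1 c := ratio1 c.1.1.1.1 c.1.1.2.2 c.1.1.2.1 c.1.1.1.2.2.
Definition dens2 c := ratio2 c.1.1.1.1 c.1.2.2 c.1.2.1 c.1.1.1.2.1.
Definition densY c := ratioY c.1.1.1.1 c.1.1.2.2 c.1.2.2 c.2.
Definition bin1 c :=
  lratio (Q1 c.1.1.1.1) (P1 c.1.1.1.1 c.1.1.1.2.1) snd c.1.1.2.2.
Definition bin2 c :=
  lratio (Q2 c.1.1.1.1) (P2 c.1.1.1.1 c.1.1.1.2.2) snd c.1.2.2.

Lemma lratio_second_law (A V : finType) (q : fdist R V) (p : fdist R (A * V)%type) v :
  lratio q p snd v = second_law p v / q v.
Proof.
rewrite /lratio /second_law /Ex mulr_suml big_mkcond; apply: eq_bigr => a _.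
by case: eqP => _; rewrite ?mulr1 ?mulr0 ?mul0r.
Qed.

Section Support.
Variable c : letters.
Hypothesis c_supp : letter_law c != 0.

Let Pc : P (to_joint c) != 0.
Proof. by rewrite P_to_joint. Qed.

Lemma supp_factors : [/\ PU c.1.1.1.1 != 0, PS c.1.1.1.2 != 0,
  P1 c.1.1.1.1 c.1.1.1.2.1 c.1.1.2 != 0 & P2 c.1.1.1.1 c.1.1.1.2.2 c.1.2 != 0].
Proof.
move: c_supp; rewrite /= /bind_val /= /bind_val /= /bind_val /= /bind_val /=.
by rewrite !mulf_eq0 !negb_or -!andbA => /and5P[-> -> -> -> _].
Qed.

Lemma aux1_gt0 : 0 < Q1 c.1.1.1.1 c.1.1.2.2.
Proof.
have [_ PSc P1c _] := supp_factors.
by rewrite lt_def fdist_ge0 andbT; apply: contra_neq P1c; exact: aux_law_abs_cont.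
Qed.

Lemma aux2_gt0 : 0 < Q2 c.1.1.1.1 c.1.2.2.
Proof.
have [_ PSc _ P2c] := supp_factors.
by rewrite lt_def fdist_ge0 andbT; apply: contra_neq P2c; exact: aux_law_abs_cont.
Qed.

Lemma second_law_gt0 (A V : finType) (p : fdist R (A * V)%type) a :
  p a != 0 -> 0 < second_law p a.2.
Proof. by move=> pa; rewrite /second_law -lawE (law_gt0 snd). Qed.

Lemma bin1_gt0 : 0 < bin1 c.
Proof.
have [_ _ P1c _] := supp_factors.
by rewrite /bin1 lratio_second_law divr_gt0 ?second_law_gt0 ?aux1_gt0.
Qed.

Lemma bin2_gt0 : 0 < bin2 c.
Proof.
have [_ _ _ P2c] := supp_factors.
by rewrite /bin2 lratio_second_law divr_gt0 ?second_law_gt0 ?aux2_gt0.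
Qed.

Lemma dens1_gt0 : 0 < dens1 c.
Proof.
have Q0 := aux1_gt0; move: Pc Q0.
have := @law_gt0 _ _ P _ (rvpair (rvpair rX1 rV1) (rvpair rU rS2)) (to_joint c).
have := @law_gt0 _ _ P _ (rvpair rX1 (rvpair rU rS2)) (to_joint c).
case: (c) => [[[[u [s1 s2]] [x1 v1]] [x2 v2]] y] /= h1 h2 /[dup] /h1 {}h1 /h2 {}h2 Q0.
by rewrite /dens1 /ratio1 /= divr_gt0 ?mulr_gt0.
Qed.

Lemma dens2_gt0 : 0 < dens2 c.
Proof.
have Q0 := aux2_gt0; move: Pc Q0.
have := @law_gt0 _ _ P _ (rvpair (rvpair rX2 rV2) (rvpair rU rS1)) (to_joint c).
have := @law_gt0 _ _ P _ (rvpair rX2 (rvpair rU rS1)) (to_joint c).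
case: (c) => [[[[u [s1 s2]] [x1 v1]] [x2 v2]] y] /= h1 h2 /[dup] /h1 {}h1 /h2 {}h2 Q0.
by rewrite /dens2 /ratio2 /= divr_gt0 ?mulr_gt0.
Qed.

Lemma densY_gt0 : 0 < densY c.
Proof.
have [PUc _ _ _] := supp_factors.
have {PUc} : 0 < PU c.1.1.1.1 by rewrite lt_def PUc fdist_ge0.
have Q1c := aux1_gt0; have Q2c := aux2_gt0; move: Pc Q1c Q2c.
have := @law_gt0 _ _ P _ (rvpair rY (rvpair (rvpair rV1 rV2) rU)) (to_joint c).
have := @law_gt0 _ _ P _ rY (to_joint c).
case: (c) => [[[[u [s1 s2]] [x1 v1]] [x2 v2]] y] /= h1 h2 /[dup] /h1 {}h1 /h2 {}h2 ? ? ?.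
by rewrite /densY /ratioY /= divr_gt0 ?mulr_gt0.
Qed.

End Support.

Definition mean (f : letters -> R) : R := Ex letter_law (fun c => log2 (f c)).

(** [Q1] cancels in [dens1] / [bin1], which leaves the density of [cond_mutual_info_diff]. *)
Lemma rate1_identity :
  cond_mutual_info P rX1 rV1 (rvpair rU rS2) - cond_mutual_info P rV1 rS1 (rvpair rU rS2) =
  mean dens1 - mean bin1.
Proof.
have VS w : P w != 0 -> law P (rvpair (rvpair rV1 rS1) (rvpair rU rS2))
    (rV1 w, rS1 w, rvpair rU rS2 w) = law P (rvpair rS1 (rvpair rU rS2))
    (rS1 w, rvpair rU rS2 w) * (fun w => second_law (P1 (rU w) (rS1 w)) (rV1 w)) w.
  by move=> _; exact: law_V1_S1_US2.
rewrite (cond_mutual_info_diff rX1 VS) Ex_to_joint /mean -ExB; apply: Ex_eq => c cs.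
rewrite log2B ?dens1_gt0 ?bin1_gt0 //; congr log2.
have := aux1_gt0 cs; rewrite /bin1 lratio_second_law /dens1 /ratio1.
case: c cs => [[[[u [s1 s2]] [x1 v1]] [x2 v2]] y] /= _ Q0.
rewrite !invfM invrK; set a := law _ _ _; set b := (law _ _ _)^-1.
by rewrite -!mulrA; congr (_ * (_ * _)); rewrite mulrCA mulVf ?mulr1 ?gt_eqF.
Qed.

Lemma rate2_identity :
  cond_mutual_info P rX2 rV2 (rvpair rU rS1) - cond_mutual_info P rV2 rS2 (rvpair rU rS1) =
  mean dens2 - mean bin2.
Proof.
have VS w : P w != 0 -> law P (rvpair (rvpair rV2 rS2) (rvpair rU rS1))
    (rV2 w, rS2 w, rvpair rU rS1 w) = law P (rvpair rS2 (rvpair rU rS1))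
    (rS2 w, rvpair rU rS1 w) * (fun w => second_law (P2 (rU w) (rS2 w)) (rV2 w)) w.
  by move=> _; exact: law_V2_S2_US1.
rewrite (cond_mutual_info_diff rX2 VS) Ex_to_joint /mean -ExB; apply: Ex_eq => c cs.
rewrite log2B ?dens2_gt0 ?bin2_gt0 //; congr log2.
have := aux2_gt0 cs; rewrite /bin2 lratio_second_law /dens2 /ratio2.
case: c cs => [[[[u [s1 s2]] [x1 v1]] [x2 v2]] y] /= _ Q0.
rewrite !invfM invrK; set a := law _ _ _; set b := (law _ _ _)^-1.
by rewrite -!mulrA; congr (_ * (_ * _)); rewrite mulrCA mulVf ?mulr1 ?gt_eqF.
Qed.

(** [densY] exceeds the information of the receiver by I(V1; V2 | U), and the two bin rates together
    exceed I(V1, V2; S1, S2 | U) by the same amount. *)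
Lemma sum_rate_identity :
  mutual_info P rY (rvpair (rvpair rV1 rV2) rU) -
  cond_mutual_info P (rvpair rV1 rV2) (rvpair rS1 rS2) rU =
  mean densY - mean bin1 - mean bin2.
Proof.
have VS w : P w != 0 -> law P (rvpair (rvpair (rvpair rV1 rV2) (rvpair rS1 rS2)) rU)
    (rvpair rV1 rV2 w, rvpair rS1 rS2 w, rU w) = law P (rvpair (rvpair rS1 rS2) rU)
    (rvpair rS1 rS2 w, rU w) * (fun w => second_law (P1 (rU w) (rS1 w)) (rV1 w) *
      second_law (P2 (rU w) (rS2 w)) (rV2 w)) w.
  by move=> _; exact: law_V_S_U.
rewrite (mutual_info_diff rY VS) Ex_to_joint /mean -!ExB; apply: Ex_eq => c cs.
have YB := divr_gt0 (densY_gt0 cs) (bin1_gt0 cs).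
rewrite !log2B ?densY_gt0 ?bin1_gt0 ?bin2_gt0 //; congr log2.
have := aux1_gt0 cs; have := aux2_gt0 cs.
rewrite /bin1 /bin2 !lratio_second_law /densY /ratioY law_U.
case: c cs {YB} => [[[[u [s1 s2]] [x1 v1]] [x2 v2]] y] /= _ Q2u Q1u.
rewrite !invfM !invrK; move: (law _ _ _) (law _ _ _)^-1 (PU u)^-1 => a b d.
move: (second_law _ _)^-1 (second_law _ _)^-1 => e f.
by field; rewrite !gt_eqF.
Qed.

End SingleLetter.

(** * Blocks of independent letters *)

Section WordScheme.
Variables (R : realType) (X1 X2 S1 S2 Y U V1 V2 : finType).
Variables (PS : fdist R (S1 * S2)%type) (W : X1 -> X2 -> S1 -> S2 -> fdist R Y).
Variables (PU : fdist R U).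
Variables (P1 : U -> S1 -> fdist R (X1 * V1)%type).
Variables (P2 : U -> S2 -> fdist R (X2 * V2)%type).
Variable P : fdist R (joint_alphabet X1 X2 S1 S2 Y U V1 V2).
Hypothesis P_joint : forall s1 s2 u v1 v2 x1 x2 y,
  P (s1, s2, u, v1, v2, x1, x2, y) =
  PS (s1, s2) * PU u * P1 u s1 (x1, v1) * P2 u s2 (x2, v2) * W x1 x2 s1 s2 y.

Local Notation Q1 := (aux_law PS P1 fst).
Local Notation Q2 := (aux_law PS P2 snd).
Local Notation J := (letter_law PS W PU P1 P2).
Local Notation mean := (mean PS W PU P1 P2).
Local Notation dens1 := (dens1 PS P1 P).
Local Notation dens2 := (dens2 PS P2 P).
Local Notation densY := (densY PS PU P1 P2 P).
Local Notation bin1 := (bin1 PS P1).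
Local Notation bin2 := (bin2 PS P2).
Local Notation var f := (variance J (fun c => log2 (f c))).

Lemma Ex_words (I A B : finType) (p : fdist R A) (K : A -> fdist R B)
    (Kn : {ffun I -> A} -> fdist R {ffun I -> B}) G :
  (forall a b, Kn a b = \prod_i K (a i) (b i)) ->
  Ex (prodf (fun=> p)) (fun a => Ex (Kn a) (G a)) =
  Ex (prodf (fun=> bind p K)) (fun c => G [ffun i => (c i).1] [ffun i => (c i).2]).
Proof.
move=> KnE; rewrite -(Ex_bind_prodf (fun=> p) (fun=> K)).
by apply: Ex_ext => a; apply: Ex_law => b; rewrite KnE.
Qed.

Section BlockLength.
Variable n : nat.

Definition PUn : fdist R {ffun 'I_n -> U} := prodf (fun=> PU).
Definition P1n (u : {ffun 'I_n -> U}) (s : {ffun 'I_n -> S1}) :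
  fdist R {ffun 'I_n -> X1 * V1} := prodf (fun i => P1 (u i) (s i)).
Definition P2n (u : {ffun 'I_n -> U}) (s : {ffun 'I_n -> S2}) :
  fdist R {ffun 'I_n -> X2 * V2} := prodf (fun i => P2 (u i) (s i)).
Definition Q1n (u : {ffun 'I_n -> U}) : fdist R {ffun 'I_n -> V1} :=
  prodf (fun i => Q1 (u i)).
Definition Q2n (u : {ffun 'I_n -> U}) : fdist R {ffun 'I_n -> V2} :=
  prodf (fun i => Q2 (u i)).
Definition rho1n (u : {ffun 'I_n -> U}) (v : {ffun 'I_n -> V1})
  (x : {ffun 'I_n -> X1}) (s : {ffun 'I_n -> S2}) : R :=
  \prod_i ratio1 PS P1 P (u i) (v i) (x i) (s i).
Definition rho2n (u : {ffun 'I_n -> U}) (v : {ffun 'I_n -> V2})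
  (x : {ffun 'I_n -> X2}) (s : {ffun 'I_n -> S1}) : R :=
  \prod_i ratio2 PS P2 P (u i) (v i) (x i) (s i).
Definition taun (u : {ffun 'I_n -> U}) (v1 : {ffun 'I_n -> V1})
  (v2 : {ffun 'I_n -> V2}) (y : {ffun 'I_n -> Y}) : R :=
  \prod_i ratioY PS PU P1 P2 P (u i) (v1 i) (v2 i) (y i).

Local Notation fstw := (fun s => fst_word s).
Local Notation sndw := (fun s => snd_word s).
Local Notation Wn := (fun x1 x2 => channel_law W x1 x2).

(** Each use of [Ex_words] absorbs one more kernel into the letter. *)
Lemma Ejoint_words G :
  Ejoint fstw sndw fstw fstw (state_law PS 'I_n) PUn P1n P2n Wn G =
  Ex (prodf (fun _ : 'I_n => J)) (fun c =>
    G [ffun i => (c i).1.1.1.1] [ffun i => (c i).1.1.1.2] [ffun i => (c i).1.1.2]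
      [ffun i => (c i).1.2] [ffun i => (c i).2]).
Proof.
rewrite /Ejoint /PUn (@Ex_words _ _ _ _ (fun=> PS)) //.
rewrite (@Ex_words _ _ _ _ (fun c => P1 c.1 c.2.1)); last first.
  by move=> a b; apply: eq_bigr => i _; rewrite !ffunE.
rewrite (@Ex_words _ _ _ _ (fun c => P2 c.1.1 c.1.2.2)); last first.
  by move=> a b; apply: eq_bigr => i _; rewrite !ffunE.
rewrite (@Ex_words _ _ _ _ (fun c => W c.1.2.1 c.2.1 c.1.1.2.1 c.1.1.2.2)); last first.
  by move=> a b; apply: eq_bigr => i _; rewrite !ffunE.
by apply: Ex_ext => c; congr (G _ _ _ _ _); apply/ffunP => i; rewrite !ffunE.
Qed.

Variables (g : R).
Hypotheses (n_gt0 : (0 < n)%N) (g_gt0 : 0 < g).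

(** Thresholds at distance [g] from the mean exponent, above it for the bins and below it for the
    tests. *)
Definition T1n : R := 2 `^ (n%:R * (mean bin1 + g)).
Definition T2n : R := 2 `^ (n%:R * (mean bin2 + g)).
Definition t1n : R := 2 `^ (n%:R * (mean dens1 - g)).
Definition t2n : R := 2 `^ (n%:R * (mean dens2 - g)).
Definition t3n : R := 2 `^ (n%:R * (mean densY - g)).

Definition spread : R :=
  var dens1 + var dens2 + var densY + 2 * var bin1 + 2 * var bin2.

Lemma Ejoint_atypical :
  Ejoint fstw sndw fstw fstw (state_law PS 'I_n) PUn P1n P2n Wn
    (atypical fstw sndw fstw sndw fstw sndw P1n P2n Q1n Q2n rho1n rho2n taun
       T1n T2n t1n t2n t3n) <= spread / (n%:R * g ^+ 2).
Proof.
rewrite Ejoint_words.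
have d1 := typical_lower (fun c cs => dens1_gt0 P_joint (c := c) cs) n_gt0 g_gt0.
have d2 := typical_lower (fun c cs => dens2_gt0 P_joint (c := c) cs) n_gt0 g_gt0.
have dY := typical_lower (fun c cs => densY_gt0 P_joint (c := c) cs) n_gt0 g_gt0.
have b1 := typical_upper (fun c (cs : J c != 0) => bin1_gt0 (c := c) cs) n_gt0 g_gt0.
have b2 := typical_upper (fun c (cs : J c != 0) => bin2_gt0 (c := c) cs) n_gt0 g_gt0.
have bound := lerD (lerD (lerD (lerD d1 d2) dY)
  (ler_wpM2l (ler0n R 2) b1)) (ler_wpM2l (ler0n R 2) b2).
apply: (le_trans _ (le_trans bound _)); last by rewrite /spread; lra.
rewrite -!ExZ -!ExD; apply: Ex_le => c _; rewrite /atypical.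
rewrite !lratio_word /rho1n /rho2n /taun /T1n /T2n /t1n /t2n /t3n.
rewrite le_eqVlt; apply/orP; left; apply/eqP.
by congr (_%R%:R + _%R%:R + _%R%:R + 2 * _%R%:R + 2 * _%R%:R); congr (nat_of_bool _);
  [congr (_ <= _)|congr (_ <= _)|congr (_ <= _)|congr (_ < _)|congr (_ < _)];
  apply: eq_bigr => i _; rewrite !ffunE.
Qed.

Lemma abs1n u (s : {ffun 'I_n -> S1 * S2}) a : state_law PS 'I_n s != 0 ->
  Q1n u (snd_word a) = 0 -> P1n u (fst_word s) a = 0.
Proof.
move=> sn0; have s0 i : PS (s i) != 0 by exact: (prodf_neq0 (Q := fun=> PS)) sn0.
rewrite /= /prodf_val => /eqP/prodf_eq0[i _].
rewrite ffunE => /eqP q0; rewrite (bigD1 i) //= ffunE.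
by rewrite (aux_law_abs_cont (s0 i) q0) mul0r.
Qed.

Lemma abs2n u (s : {ffun 'I_n -> S1 * S2}) a : state_law PS 'I_n s != 0 ->
  Q2n u (snd_word a) = 0 -> P2n u (snd_word s) a = 0.
Proof.
move=> sn0; have s0 i : PS (s i) != 0 by exact: (prodf_neq0 (Q := fun=> PS)) sn0.
rewrite /= /prodf_val => /eqP/prodf_eq0[i _].
rewrite ffunE => /eqP q0; rewrite (bigD1 i) //= ffunE.
by rewrite (aux_law_abs_cont (s0 i) q0) mul0r.
Qed.

Lemma Ex_rho1n u x s : Ex (Q1n u) (fun v => rho1n u v x s) <= 1.
Proof.
rewrite /rho1n (Ex_prod _ (fun i v => ratio1 PS P1 P (u i) v (x i) (s i))).
by apply: prodr_ile1 => i _; rewrite Ex_ratio1 andbT Ex_ge0 // => v; exact: ratio1_ge0.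
Qed.

Lemma Ex_rho2n u x s : Ex (Q2n u) (fun v => rho2n u v x s) <= 1.
Proof.
rewrite /rho2n (Ex_prod _ (fun i v => ratio2 PS P2 P (u i) v (x i) (s i))).
by apply: prodr_ile1 => i _; rewrite Ex_ratio2 andbT Ex_ge0 // => v; exact: ratio2_ge0.
Qed.

Lemma Ex_taun y : Ex PUn (fun u => Ex (Q1n u) (fun v => Ex (Q2n u)
  (fun v' => taun u v v' y))) <= 1.
Proof.
have -> : Ex PUn (fun u => Ex (Q1n u) (fun v => Ex (Q2n u) (fun v' => taun u v v' y))) =
    \prod_(i < n) Ex PU (fun u => Ex (Q1 u) (fun v => Ex (Q2 u)
      (fun v' => ratioY PS PU P1 P2 P u v v' (y i)))).
  rewrite -Ex_prod; apply: Ex_ext => u; rewrite -Ex_prod; apply: Ex_ext => v.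
  by rewrite -Ex_prod.
apply: prodr_ile1 => i _; rewrite Ex_ratioY andbT.
by do 3![apply: Ex_ge0 => ?]; exact: ratioY_ge0.
Qed.

Lemma word_scheme_exists (K1 K2 : finType) (k1 : K1) (k2 : K2) (L1 L2 : nat) (alpha : R) :
  0 < alpha ->
  exists (Th : finType) (D : fdist R Th) (sc : Th -> block_scheme K1 K2
      {ffun 'I_n -> S1} {ffun 'I_n -> S2} {ffun 'I_n -> X1} {ffun 'I_n -> X2}
      {ffun 'I_n -> Y}),
    forall m' m : K1 * K2,
    Ex D (fun th => block_error (@fst_word 'I_n S1 S2) (@snd_word 'I_n S1 S2)
      (state_law PS 'I_n) Wn (sc th) m' m) <=
    spread / (n%:R * g ^+ 2) +
    ((#|K1|.-1 * L1.+1)%:R / t1n + (#|K2|.-1 * L2.+1)%:R / t2n +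
     ((#|K1| * #|K2|).-1 * (L1.+1 * L2.+1))%:R / t3n +
     2 * (alpha + T1n / (alpha * L1.+1%:R)) + 2 * (alpha + T2n / (alpha * L2.+1%:R))).
Proof.
move=> alpha0.
have r1 u v x s : 0 <= rho1n u v x s by apply: prodr_ge0 => i _; exact: ratio1_ge0.
have r2 u v x s : 0 <= rho2n u v x s by apply: prodr_ge0 => i _; exact: ratio2_ge0.
have rY u v v' y : 0 <= taun u v v' y by apply: prodr_ge0 => i _; exact: ratioY_ge0.
have pw z : 0 < 2 `^ z :> R by rewrite powR_gt0.
have T1p : 0 <= T1n := ltW (pw _).
have T2p : 0 <= T2n := ltW (pw _).
have t1p : 0 < t1n := pw _.
have t2p : 0 < t2n := pw _.
have t3p : 0 < t3n := pw _.
have H := one_shot k1 k2 (ord0 : 'I_L1.+1) (ord0 : 'I_L2.+1) fstw fstw Wn abs1n abs2n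
  r1 r2 rY Ex_rho1n Ex_rho2n Ex_taun T1p T2p alpha0 t1p t2p t3p.
exists (randomness K1 K2 'I_L1.+1 'I_L2.+1 {ffun 'I_n -> S1} {ffun 'I_n -> S2}
  {ffun 'I_n -> U} {ffun 'I_n -> X1 * V1} {ffun 'I_n -> X2 * V2}
  {ffun 'I_n -> V1} {ffun 'I_n -> V2}).
exists (random_law K1 K2 ord0 ord0 sndw sndw PUn P1n P2n Q1n Q2n).
exists (random_scheme k1 k2 fstw fstw rho1n rho2n taun t1n t2n t3n) => m' m.
apply: le_trans (H m' m) _.
rewrite !card_ord lerD2r; exact: Ejoint_atypical.
Qed.

End BlockLength.
End WordScheme.

(** * Margins of the exponents *)

Section Rates.
Variable R : realType.

Lemma pow2D (x y : R) : 2 `^ (x + y) = 2 `^ x * 2 `^ y.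
Proof. by rewrite powRD // pnatr_eq0 implybT. Qed.

Lemma pow2_gt0 (x : R) : 0 < 2 `^ x.
Proof. by rewrite powR_gt0. Qed.

Lemma pow2_ge1 (x : R) : 0 <= x -> 1 <= 2 `^ x.
Proof. by move=> x0; rewrite -[leLHS](powRr0 2) ler_pow2. Qed.

Definition bins (x : R) : nat := Num.truncn (2 `^ x).

Lemma bins_lower (x : R) : 2 `^ x <= (bins x).+1%:R.
Proof. by rewrite ltW // truncnS_gt. Qed.

Lemma bins_upper (x : R) : 0 <= x -> (bins x).+1%:R <= 2 * 2 `^ x.
Proof.
move=> x0; rewrite -natr1 mulr_natl mulr2n lerD ?pow2_ge1 //.
by rewrite truncn_le ltW ?pow2_gt0.
Qed.

(** Bins of exponent a + 2g against a threshold of exponent a + g leave a margin of g. *)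
Lemma covering_rate (n a g alpha : R) : 0 < alpha ->
  2 `^ (n * (a + g)) / (alpha * (bins (n * (a + 2 * g))).+1%:R) <=
  2 `^ (- (n * g)) / alpha.
Proof.
move=> alpha0; rewrite invfM mulrA [_ / alpha]mulrC -mulrA [leRHS]mulrC.
rewrite ler_wpM2l ?invr_ge0 ?(ltW alpha0) // ler_pdivrMr ?ltr0n //.
apply: le_trans (ler_wpM2l (ltW (pow2_gt0 _)) (bins_lower _)).
by rewrite -pow2D ler_pow2; lra.
Qed.

(** Exponents add up to (b - a - 4g) + (a + 2g) - (b - g) = -g. *)
Lemma packing_rate (n a b g K : R) : 0 <= n -> 0 <= a -> 0 <= g -> 0 <= K ->
  K <= 2 `^ (n * (b - a - 4 * g)) ->
  K * (bins (n * (a + 2 * g))).+1%:R / 2 `^ (n * (b - g)) <= 2 * 2 `^ (- (n * g)).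
Proof.
move=> n0 a0 g0 K0 Kle; rewrite ler_pdivrMr ?pow2_gt0 //.
have ub : (bins (n * (a + 2 * g))).+1%:R <= 2 * 2 `^ (n * (a + 2 * g)).
  by apply: bins_upper; rewrite mulr_ge0 ?addr_ge0 ?mulr_ge0.
apply: le_trans (ler_pM K0 (ler0n _ _) Kle ub) _.
rewrite mulrCA -mulrA -!pow2D ler_wpM2l ?ler0n // ler_pow2; lra.
Qed.

(** The receiver searches two bins, hence 6g: (b - a - a' - 6g) + (a + 2g) + (a' + 2g) - (b - g) =
    -g. *)
Lemma packing_rate2 (n a a' b g K : R) :
  0 <= n -> 0 <= a -> 0 <= a' -> 0 <= g -> 0 <= K ->
  K <= 2 `^ (n * (b - a - a' - 6 * g)) ->
  K * ((bins (n * (a + 2 * g))).+1%:R * (bins (n * (a' + 2 * g))).+1%:R) /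
    2 `^ (n * (b - g)) <= 4 * 2 `^ (- (n * g)).
Proof.
move=> n0 a0 a'0 g0 K0 Kle; rewrite ler_pdivrMr ?pow2_gt0 //.
have ub : (bins (n * (a + 2 * g))).+1%:R <= 2 * 2 `^ (n * (a + 2 * g)).
  by apply: bins_upper; rewrite mulr_ge0 ?addr_ge0 ?mulr_ge0.
have ub' : (bins (n * (a' + 2 * g))).+1%:R <= 2 * 2 `^ (n * (a' + 2 * g)).
  by apply: bins_upper; rewrite mulr_ge0 ?addr_ge0 ?mulr_ge0.
have ub2 := ler_pM (ler0n _ _) (ler0n _ _) ub ub'.
apply: le_trans (ler_pM K0 _ Kle ub2) _; first by rewrite mulr_ge0.
rewrite mulrACA -pow2D mulrCA -!mulrA -!pow2D.
have -> : (2 : R) * (2 * 2 `^ (n * (b - a - a' - 6 * g) +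
    (n * (a + 2 * g) + n * (a' + 2 * g)))) =
  4 * 2 `^ (n * (b - a - a' - 6 * g) + (n * (a + 2 * g) + n * (a' + 2 * g))) by ring.
by rewrite ler_wpM2l ?ler0n // ler_pow2; lra.
Qed.

End Rates.

(** * Block schemes of small error *)

Section BlockScheme.
Variables (R : realType) (X1 X2 S1 S2 Y U V1 V2 : finType).
Variables (PS : fdist R (S1 * S2)%type) (W : X1 -> X2 -> S1 -> S2 -> fdist R Y).
Variables (PU : fdist R U).
Variables (P1 : U -> S1 -> fdist R (X1 * V1)%type).
Variables (P2 : U -> S2 -> fdist R (X2 * V2)%type).
Variable P : fdist R (joint_alphabet X1 X2 S1 S2 Y U V1 V2).
Hypothesis P_joint : forall s1 s2 u v1 v2 x1 x2 y,
  P (s1, s2, u, v1, v2, x1, x2, y) =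
  PS (s1, s2) * PU u * P1 u s1 (x1, v1) * P2 u s2 (x2, v2) * W x1 x2 s1 s2 y.

Local Notation mean := (mean PS W PU P1 P2).

Lemma mean_bin1_ge0 : 0 <= mean (bin1 PS P1).
Proof.
rewrite /mean /letter_law Ex_bind /input_law Ex_bind /source1_law Ex_bind /=.
apply: Ex_ge_cst => -[u s] us; apply: le_trans (log2_lratio_ge0 (Q := aux_law PS P1 fst u)
  (p := P1 u s.1) (v := snd) _) _.
  move=> a; apply: aux_law_abs_cont.
  by move: us; rewrite /= /bind_val mulf_eq0 negb_or => /andP[].
apply: Ex_le => a _; by do 2![apply: Ex_ge_cst => ? _].
Qed.

Lemma mean_bin2_ge0 : 0 <= mean (bin2 PS P2).
Proof.
rewrite /mean /letter_law Ex_bind /input_law Ex_bind /source1_law Ex_bind /=.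
apply: Ex_ge_cst => -[u s] us; apply: Ex_ge_cst => a _.
apply: le_trans (log2_lratio_ge0 (Q := aux_law PS P2 snd u)
  (p := P2 u s.2) (v := snd) _) _.
  move=> b; apply: aux_law_abs_cont.
  by move: us; rewrite /= /bind_val mulf_eq0 negb_or => /andP[].
by apply: Ex_le => b _; apply: Ex_ge_cst.
Qed.

Theorem block_scheme_exists (g eta : R) : 0 < g -> 0 < eta ->
  exists n0, forall n, (n0 <= n)%N -> forall (K1 K2 : finType) (k1 : K1) (k2 : K2),
  #|K1|.-1%:R <= 2 `^ (n%:R * (mean (dens1 PS P1 P) - mean (bin1 PS P1) - 4 * g)) ->
  #|K2|.-1%:R <= 2 `^ (n%:R * (mean (dens2 PS P2 P) - mean (bin2 PS P2) - 4 * g)) ->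
  (#|K1| * #|K2|).-1%:R <= 2 `^ (n%:R * (mean (densY PS PU P1 P2 P) -
     mean (bin1 PS P1) - mean (bin2 PS P2) - 6 * g)) ->
  exists (Th : finType) (D : fdist R Th) (sc : Th -> block_scheme K1 K2
      {ffun 'I_n -> S1} {ffun 'I_n -> S2} {ffun 'I_n -> X1} {ffun 'I_n -> X2}
      {ffun 'I_n -> Y}),
    forall m' m : K1 * K2,
    Ex D (fun th => block_error (@fst_word 'I_n S1 S2) (@snd_word 'I_n S1 S2)
      (state_law PS 'I_n) (fun x1 x2 => channel_law W x1 x2) (sc th) m' m) <= eta.
Proof.
move=> g0 eta0.
(* The coverings contribute 4 alpha, which takes half of [eta]. *)
have [alpha [alpha0 alphaE]] : exists alpha : R, 0 < alpha /\ 8 * alpha = eta.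
  by exists (eta / 8); split; [rewrite divr_gt0|field].
pose V := spread PS W PU P1 P2 P / g ^+ 2.
(* 8 = 2 + 2 + 4 collects the three packing terms and 4 / alpha the covering terms; the length is
   then chosen so that C / n is at most the other half of [eta]. *)
pose C := V + (8 + 4 / alpha) / (g * ln 2).
exists (Num.truncn (2 * C / eta)).+1 => n n_large K1 K2 k1 k2 hK1 hK2 hK.
have n_gt0 : (0 < n)%N by apply: leq_trans n_large.
have nR : 0 < n%:R :> R by rewrite ltr0n.
have a1 := mean_bin1_ge0; have a2 := mean_bin2_ge0.
have [Th [D [sc sc_error]]] := word_scheme_exists P_joint n_gt0 g0 k1 k2
  (bins (n%:R * (mean (bin1 PS P1) + 2 * g))) (bins (n%:R * (mean (bin2 PS P2) + 2 * g)))
  alpha0.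
exists Th, D, sc => m' m; apply: le_trans (sc_error m' m) _.
rewrite /T1n /T2n /t1n /t2n /t3n !natrM.
have c1 := covering_rate n%:R (mean (bin1 PS P1)) g alpha0.
have c2 := covering_rate n%:R (mean (bin2 PS P2)) g alpha0.
have p1 := packing_rate (ltW nR) a1 (ltW g0) (ler0n _ _) hK1.
have p2 := packing_rate (ltW nR) a2 (ltW g0) (ler0n _ _) hK2.
have p3 := packing_rate2 (ltW nR) a1 a2 (ltW g0) (ler0n _ _) hK.
have z_le : 2 `^ (- (n%:R * g)) <= (g * ln 2)^-1 / n%:R.
  have -> : (g * ln 2)^-1 / n%:R = (n%:R * g * ln 2)^-1.
    by rewrite -invfM; congr (_^-1); ring.
  by rewrite powR_inv_le // mulr_gt0.
have V_le : spread PS W PU P1 P2 P / (n%:R * g ^+ 2) = V / n%:R.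
  by rewrite /V; field; rewrite !gt_eqF.
have C_le : C / n%:R <= eta / 2.
  have : 2 * C / eta < n%:R.
    by apply: lt_le_trans (truncnS_gt _) _; rewrite ler_nat.
  rewrite ltr_pdivrMr // ler_pdivrMr // => /ltW; lra.
rewrite V_le.
have za : 2 `^ (- (n%:R * g)) / alpha <= (g * ln 2)^-1 / n%:R / alpha.
  by rewrite ler_wpM2r // invr_ge0 ltW.
have CE : C / n%:R = V / n%:R + 8 * ((g * ln 2)^-1 / n%:R) + 4 * ((g * ln 2)^-1 / n%:R / alpha).
  rewrite /C; field; rewrite !gt_eqF ?ln2_gt0 //.
have combine (v q1 q2 q3 r1 r2 z w z' w' c : R) : r1 <= z' -> r2 <= z' ->
    q1 <= 2 * z -> q2 <= 2 * z -> q3 <= 4 * z -> z <= w -> z' <= w' ->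
    c = v + 8 * w + 4 * w' -> c <= eta / 2 ->
    v + (q1 + q2 + q3 + 2 * (alpha + r1) + 2 * (alpha + r2)) <= eta.
  by move: alphaE; lra.
exact: combine c1 c2 p1 p2 p3 z_le za CE C_le.
Qed.

End BlockScheme.

(** * Achievability *)

Lemma exists_ord_inj (T : finType) (M : nat) : (M <= #|T|)%N ->
  exists f : 'I_M -> T, injective f.
Proof.
move=> MT; exists (fun i => enum_val (widen_ord MT i)).
by move=> i j /enum_val_inj/(congr1 val) /= /val_inj.
Qed.

Section Achievability.
Variables (R : realType) (X1 X2 S1 S2 Y : finType).
Variables (PS : fdist R (S1 * S2)%type) (W : X1 -> X2 -> S1 -> S2 -> fdist R Y).

Lemma average_error_ge0 n M1 M2 (c : Defs.code X1 X2 S1 S2 Y n M1 M2) :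
  0 <= average_error PS W c.
Proof.
rewrite /average_error mulr_ge0 ?invr_ge0 ?ler0n //.
do 2![apply: sumr_ge0 => ? _]; rewrite /error_given.
do 2![apply: sumr_ge0 => ? _]; rewrite mulr_ge0 //.
  by apply: prodr_ge0 => i _; exact: fdist_ge0.
by do 3![apply: sumr_ge0 => ? _]; apply: prodr_ge0 => i _; exact: fdist_ge0.
Qed.

(* A code of almost minimal error for each length turns error bounds that hold
   eventually, for each tolerance separately, into a single sequence. *)
Lemma achievable_of_eventually (r : R * R) : 0 <= r.1 -> 0 <= r.2 ->
  (forall n, exists c : Defs.code X1 X2 S1 S2 Y n (num_messages n r.1)
     (num_messages n r.2), True) ->
  (forall e : R, 0 < e -> exists n0, forall n, (n0 <= n)%N ->
     exists c : Defs.code X1 X2 S1 S2 Y n (num_messages n r.1) (num_messages n r.2),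
       average_error PS W c <= e) ->
  achievable PS W r.
Proof.
move=> r1 r2 code0 eventually; split => //.
pose errs n : set R := fun x => exists c : Defs.code X1 X2 S1 S2 Y n
  (num_messages n r.1) (num_messages n r.2), x = average_error PS W c.
have errs_lb n : lbound (errs n) 0 by move=> _ [c ->]; exact: average_error_ge0.
have errs_inf n : has_inf (errs n).
  by split; [have [c _] := code0 n; exists (average_error PS W c), c|exists 0].
have best n : exists c : Defs.code X1 X2 S1 S2 Y n (num_messages n r.1)
    (num_messages n r.2), average_error PS W c < inf (errs n) + n.+1%:R^-1.
  have n0 : 0 < n.+1%:R^-1 :> R by rewrite invr_gt0 ltr0n.
  by have [_ [c ->] h] := inf_adherent n0 (errs_inf n); exists c.
pose c n := sval (cid (best n)).
have hc n : average_error PS W (c n) < inf (errs n) + n.+1%:R^-1 := svalP (cid (best n)).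
exists c; apply/cvgrPdist_le => e e0.
have e2 : 0 < e / 2 by rewrite divr_gt0.
have [n0 hn0] := eventually _ e2.
exists (maxn n0 (Num.truncn (2 / e))) => // n /=.
rewrite geq_max => /andP[n0n ne].
rewrite sub0r normrN ger0_norm ?average_error_ge0 //.
apply: le_trans (ltW (hc n)) _.
have [c' c'e] := hn0 n n0n.
have inf_le : inf (errs n) <= e / 2.
  by apply: le_trans c'e; apply: ge_inf; [exists 0|exists c'].
have inv_le : n.+1%:R^-1 <= e / 2 :> R.
  rewrite -[leRHS]invrK lef_pV2 ?posrE ?invr_gt0 ?ltr0n // invf_div.
  by apply: le_trans (ltW (truncnS_gt _)) _; rewrite ler_nat ltnS.
by rewrite [leRHS]splitr lerD.
Qed.

Section Inhabited.
Variables (x10 : X1) (x20 : X2) (s10 : S1) (s20 : S2) (y0 : Y).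

(** The mean over the random scheme is taken after summing over blocks and messages, so a single
    outcome serves the whole average error. *)
Lemma chain_average (n B N M1 M2 : nat) (K1 K2 : finType) (k1 : K1) (k2 : K2)
    (eta : R) (Th : finType) (D : fdist R Th)
    (sc : Th -> block_scheme K1 K2 {ffun 'I_n -> S1} {ffun 'I_n -> S2}
       {ffun 'I_n -> X1} {ffun 'I_n -> X2} {ffun 'I_n -> Y}) :
  (0 < M1)%N -> (0 < M2)%N -> (M1 <= #|K1| ^ B)%N -> (M2 <= #|K2| ^ B)%N ->
  (n * B.+1 <= N)%N ->
  (forall m' m : K1 * K2,
    Ex D (fun th => block_error (@fst_word 'I_n S1 S2) (@snd_word 'I_n S1 S2)
      (state_law PS 'I_n) (fun x1 x2 => channel_law W x1 x2) (sc th) m' m) <= eta) ->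
  exists c : Defs.code X1 X2 S1 S2 Y N M1 M2,
    average_error PS W c <= B.+1%:R * eta.
Proof.
move=> M1_gt0 M2_gt0 M1K M2K nBN sc_err.
have [|phi1 phi1_inj] := @exists_ord_inj {ffun 'I_B -> K1} M1.
  by rewrite card_ffun card_ord.
have [|phi2 phi2_inj] := @exists_ord_inj {ffun 'I_B -> K2} M2.
  by rewrite card_ffun card_ord.
pose c th := chain_code N x10 x20 s10 s20 y0 k1 k2 (Ordinal M1_gt0) (Ordinal M2_gt0)
  phi1 phi2 (sc th).
suff : Ex D (fun th => average_error PS W (c th)) <= B.+1%:R * eta.
  by move=> /exists_le_Ex[th]; exists (c th).
rewrite /average_error ExZ Ex_sum.
under eq_bigr do rewrite Ex_sum.
rewrite ler_pdivrMl; last by rewrite ltr0n muln_gt0 M1_gt0.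
apply: (@le_trans _ _ (\sum_(w1 < M1) \sum_(w2 < M2) B.+1%:R * eta)); last first.
  by rewrite !sumr_const !card_ord -mulrnA [leRHS]mulr_natl mulnC.
apply: ler_sum => w1 _; apply: ler_sum => w2 _.
apply: (@le_trans _ _ (\sum_(b < B.+1) eta)); last first.
  by rewrite sumr_const card_ord mulr_natl.
apply: le_trans (Ex_le (fun th _ => chain_error x10 x20 s10 s20 y0 k1 k2
  (Ordinal M1_gt0) (Ordinal M2_gt0) (sc th) phi1_inj phi2_inj nBN w1 w2 PS W)) _.
by rewrite Ex_sum; apply: ler_sum => b _; exact: sc_err.
Qed.

End Inhabited.

End Achievability.

(** * Numbers of messages per block *)

Section MessageCount.
Variable R : realType.

(** Rounded up so that [B] blocks can carry the whole message. Rate 0 is set apart: rounding up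
    would give two messages, which the packing condition excludes once the margin makes its exponent
    negative. *)
Definition block_messages (N B : nat) (r : R) : nat :=
  if r == 0 then 1%N else (Num.truncn (2 `^ (N%:R * r / B%:R))).+1.

Lemma num_messages_gt0 n (r : R) : 0 <= r -> (0 < num_messages n r)%N.
Proof. by move=> r0; rewrite /num_messages truncn_gt0 pow2_ge1 // mulr_ge0. Qed.

Lemma num_messages_le N B (r : R) : (0 < B)%N -> 0 <= r ->
  (num_messages N r <= block_messages N B r ^ B)%N.
Proof.
move=> B0 r0; rewrite /block_messages /num_messages.
have [->|rn0] := eqVneq r 0; first by rewrite mulr0 powRr0 truncn1 exp1n.
rewrite -(ler_nat R); apply: (@le_trans _ _ (2 `^ (N%:R * r))).
  by rewrite truncn_le ltW // pow2_gt0.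
have -> : 2 `^ (N%:R * r) = (2 `^ (N%:R * r / B%:R)) ^+ B :> R.
  by rewrite -powR_mulrn ?ltW ?pow2_gt0 // -powRrM divfK // pnatr_eq0 -lt0n.
by rewrite natrX lerXn2r ?nnegrE ?ltW ?pow2_gt0 ?truncnS_gt.
Qed.

Lemma block_messages_gt0 N B (r : R) : (0 < block_messages N B r)%N.
Proof. by rewrite /block_messages; case: eqP. Qed.

Lemma block_messages_pred N B (r : R) :
  (block_messages N B r).-1%:R <= (r != 0)%:R * 2 `^ (N%:R * r / B%:R) :> R.
Proof.
rewrite /block_messages; case: eqP => _ /=; first by rewrite mul0r.
by rewrite mul1r truncn_le ltW // pow2_gt0.
Qed.

Lemma block_messages_le N B (r : R) : 0 <= r ->
  (block_messages N B r)%:R <= 2 * 2 `^ (N%:R * r / B%:R) :> R.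
Proof.
move=> r0; rewrite -(prednK (block_messages_gt0 N B r)) -natr1 mulr_natl mulr2n.
have e0 : 0 <= N%:R * r / B%:R by rewrite divr_ge0 ?mulr_ge0.
rewrite lerD ?pow2_ge1 //; apply: le_trans (block_messages_pred N B r) _.
by rewrite ler_piMl ?(ltW (pow2_gt0 _)) //; case: (_ != _).
Qed.

End MessageCount.

(** * From the rate region to the capacity region *)

Section Region.
Variables (R : realType) (X1 X2 S1 S2 Y : finType).
Variables (PS : fdist R (S1 * S2)%type) (W : X1 -> X2 -> S1 -> S2 -> fdist R Y).

Lemma rate_region_achievable (r : R * R) (eps : R) : 0 < eps -> rate_region PS W r ->
  achievable PS W (Num.max 0 (r.1 - eps), Num.max 0 (r.2 - eps)).
Proof.
case: r => R1 R2 eps0 [/= R1_ge0 [R2_ge0 [U [V1 [V2 [P [[PU [P1 [P2 P_joint]]] [/= b1 b2 b3]]]]]]]].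
rewrite (rate1_identity P_joint) in b1; rewrite (rate2_identity P_joint) in b2.
rewrite (sum_rate_identity P_joint) in b3.
set D1 := _ - _ in b1; set D2 := _ - _ in b2; set D3 := _ - _ in b3.
set r1 := Num.max 0 _; set r2 := Num.max 0 _.
have r1_ge0 : 0 <= r1 by rewrite le_max lexx.
have r2_ge0 : 0 <= r2 by rewrite le_max lexx.
have r1E : r1 != 0 -> r1 = R1 - eps.
  by rewrite /r1; case: (leP 0 (R1 - eps)) => //; rewrite eqxx.
have r2E : r2 != 0 -> r2 = R2 - eps.
  by rewrite /r2; case: (leP 0 (R2 - eps)) => //; rewrite eqxx.
have [[s10 s20] _] := fdist_inhabited PS.
have [u0 _] := fdist_inhabited PU.
have [[x10 _] _] := fdist_inhabited (P1 u0 s10).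
have [[x20 _] _] := fdist_inhabited (P2 u0 s20).
have [y0 _] := fdist_inhabited (W x10 x20 s10 s20).
(* The argument uses 8 g: 6 g for the exponents, g for the extra block and g for constant terms; 16
   is a comfortable choice. *)
have [g [g0 gE]] : exists g : R, 0 < g /\ 16 * g = eps.
  by exists (eps / 16); split; [rewrite divr_gt0|field].
(* Enough blocks for the extra one to cost at most [g] in rate. *)
pose B := (Num.truncn ((r1 + r2) / g)).+1.
have Bg : (r1 + r2) / B%:R <= g.
  rewrite ler_pdivrMr ?ltr0n // mulrC -ler_pdivrMr //.
  by rewrite ltW // truncnS_gt.
apply: achievable_of_eventually => //= [n|e e0].
  by exists (Defs.Code (fun _ _ _ _ => x10) (fun _ _ _ _ => x20) (fun=>
    (Ordinal (num_messages_gt0 n r1_ge0), Ordinal (num_messages_gt0 n r2_ge0)))).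
(* Each of the [B.+1] blocks gets an equal share of the tolerance [e]. *)
have [n0 block_ok] := block_scheme_exists P_joint g0
  (divr_gt0 e0 (ltr0Sn R B)).
(* Makes n g dominate the terms of [expo] that do not grow with n, plus 2 for the two factors 2 of
   [block_messages_le]. *)
pose n1 := (Num.truncn ((r1 + r2 + g + 2) / g)).+1.
exists (maxn n0 n1 * B.+1)%N => N N_large.
pose n := (N %/ B.+1)%N.
have n_large : (maxn n0 n1 <= n)%N by rewrite /n leq_divRL.
have n0n : (n0 <= n)%N by apply: leq_trans n_large; exact: leq_maxl.
have n1n : (r1 + r2 + g + 2) / g <= n%:R.
  apply: le_trans (ltW (truncnS_gt _)) _; rewrite ler_nat.
  by apply: leq_trans n_large; exact: leq_maxr.
have nB : (n * B.+1 <= N)%N by exact: leq_trunc_div.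
pose K1 := block_messages N B r1; pose K2 := block_messages N B r2.
have nR : 0 <= n%:R :> R by exact: ler0n.
have ng : r1 + r2 + g + 2 <= n%:R * g by rewrite -ler_pdivrMr.
(* From N <= (n + 1)(B + 1) and r / B <= g, the exponent per block is at most (n + 1)(r + g). *)
have expo r : 0 <= r -> r <= r1 + r2 ->
    N%:R * r / B%:R <= n%:R * r + (r + g * n%:R + g).
  move=> r_ge0 r_le.
  have N_le : N%:R <= (n%:R + 1) * (B%:R + 1) :> R.
    by rewrite natr1 natr1 -natrM ler_nat ltnW // -ltn_divLR.
  have rB : r / B%:R <= g.
    by apply: le_trans Bg; rewrite ler_pM2r ?invr_gt0 ?ltr0n.
  have n1_ge0 : 0 <= n%:R + 1 :> R by rewrite addr_ge0.
  apply: (@le_trans _ _ ((n%:R + 1) * (r + r / B%:R))).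
    rewrite -mulrA; apply: le_trans (ler_wpM2r _ N_le) _; first by rewrite divr_ge0.
    by rewrite le_eqVlt; apply/orP; left; apply/eqP; field; rewrite pnatr_eq0.
  apply: le_trans (ler_wpM2l n1_ge0 (lerD (lexx r) rB)) _; lra.
have rate_le r D : r <= r1 + r2 -> r <= D - eps ->
    n%:R * r + (r + g * n%:R + g) + 2 <= n%:R * (D - 6 * g).
  move=> r_le rD; have := mulr_ge0 nR (_ : 0 <= D - 6 * g - (r + 2 * g)).
  by move=> /(_ ltac:(lra)); lra.
have [] := block_ok n n0n 'I_K1 'I_K2 (Ordinal (block_messages_gt0 N B r1))
  (Ordinal (block_messages_gt0 N B r2)).
- rewrite card_ord; apply: le_trans (block_messages_pred N B r1) _.
  have [_|rn0] := eqVneq r1 0; first by rewrite mul0r ltW ?pow2_gt0.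
  rewrite mul1r ler_pow2 -/D1.
  have r1D : r1 <= D1 - eps by rewrite r1E // lerD2r.
  have r1_le : r1 <= r1 + r2 by rewrite lerDl.
  have := expo _ r1_ge0 r1_le; have := rate_le _ _ r1_le r1D.
  by have := mulr_ge0 nR (ltW g0); lra.
- rewrite card_ord; apply: le_trans (block_messages_pred N B r2) _.
  have [_|rn0] := eqVneq r2 0; first by rewrite mul0r ltW ?pow2_gt0.
  rewrite mul1r ler_pow2 -/D2.
  have r2D : r2 <= D2 - eps by rewrite r2E // lerD2r.
  have r2_le : r2 <= r1 + r2 by rewrite lerDr.
  have := expo _ r2_ge0 r2_le; have := rate_le _ _ r2_le r2D.
  by have := mulr_ge0 nR (ltW g0); lra.
- rewrite !card_ord -/D3.
  have [r0|rn0] := eqVneq (r1 + r2) 0.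
    have r10 : r1 = 0 by apply: le_anti; rewrite r1_ge0 andbT -r0 lerDl.
    have r20 : r2 = 0 by apply: le_anti; rewrite r2_ge0 andbT -r0 lerDr.
    by rewrite /K1 /K2 /block_messages r10 r20 eqxx ltW ?pow2_gt0.
  (* If one rate is cut off at 0, nonnegativity of the original rate gives the bound; if neither is,
     there is a surplus [eps]. *)
  have rD : r1 + r2 <= D3 - eps.
    have [z1|/r1E e1] := eqVneq r1 0; have [z2|/r2E e2] := eqVneq r2 0.
    - by rewrite z1 z2 addr0 eqxx in rn0.
    - by rewrite z1 e2; lra.
    - by rewrite z2 e1; lra.
    - by rewrite e1 e2; lra.
  apply: (@le_trans _ _ ((K1 * K2)%:R)); first by rewrite ler_nat leq_pred.
  rewrite natrM.
  apply: le_trans (ler_pM (ler0n _ _) (ler0n _ _)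
    (block_messages_le N B r1_ge0) (block_messages_le N B r2_ge0)) _.
  have two : (2 : R) = 2 `^ 1 by rewrite powRr1.
  rewrite {1 3}two -!pow2D ler_pow2.
  have := expo _ (addr_ge0 r1_ge0 r2_ge0) (lexx _).
  by have := rate_le _ _ (lexx _) rD; lra.
move=> Th [D [sc sc_ok]].
have [] := chain_average x10 x20 s10 s20 y0 (Ordinal (block_messages_gt0 N B r1))
  (Ordinal (block_messages_gt0 N B r2)) (num_messages_gt0 N r1_ge0)
  (num_messages_gt0 N r2_ge0) _ _ nB sc_ok.
- by rewrite card_ord; exact: num_messages_le.
- by rewrite card_ord; exact: num_messages_le.
move=> c c_err; exists c; apply: le_trans c_err _.
by rewrite mulrC divfK // gt_eqF // ltr0n.
Qed.

End Region.

Theorem theorem1 (R : realType) (X1 X2 S1 S2 Y : finType)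
    (PS : fdist R (S1 * S2)%type)
    (W : X1 -> X2 -> S1 -> S2 -> fdist R Y) :
  rate_region PS W `<=` capacity_region PS W.
Proof.
have close (x e : R) : 0 < e -> 0 <= x -> `|x - Num.max 0 (x - e / 2)| < e.
  move=> e0 x0; case: (leP 0 (x - e / 2)) => h.
    by rewrite ger0_norm; lra.
  by rewrite subr0 ger0_norm //; lra.
move=> r r_in A /nbhs_ballP[e /= e0 eA].
have e2 : 0 < e / 2 by rewrite divr_gt0.
have [r1_ge0 [r2_ge0 _]] := r_in.
exists (Num.max 0 (r.1 - e / 2), Num.max 0 (r.2 - e / 2)); split.
  exact: rate_region_achievable.
by apply: eA; split => /=; exact: close.
Qed.
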